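(* Fix $q\in(2,4]$. Let $\mathcal{K}$ be a tame knot class such that $\mathscr{C}(\mathcal{K})$ contains a $D_2$-symmetric curve. Let $\vartheta_j\to0$ and, for each $j$, let $\Gamma_{\vartheta_j}\in\mathscr{C}(\mathcal{K})$ be an arclength parametrized $D_2$-symmetric curve with $E_{\vartheta_j}(\Gamma_{\vartheta_j})\le E_{\vartheta_j}(\beta)$ for all $D_2$-symmetric $\beta\in\mathscr{C}(\mathcal{K})$. Then there exist an arclength parametrized $D_2$-symmetric curve $\Gamma_0\in W^{2,2}(\mathbb{R}/\mathbb{Z},\mathbb{R}^3)$ and a subsequence $(\Gamma_{\vartheta_{j_k}})_k$ converging weakly in $W^{2,2}$ and strongly in $C^1$ to $\Gamma_0$ as $k\to\infty$. Moreover, $E(\Gamma_0)\le E(\beta)$ for all $D_2$-symmetric $\beta\in\mathscr{C}(\mathcal{K})$.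
   Context: $\mathscr{L}$ is length; $E(\gamma)=\int_\gamma\kappa^2ds$; for $q\in(2,4]$, $\mathrm{TP}_q(\gamma)=\iint_{(\mathbb{R}/\mathbb{Z})^2} r_{tp}(\gamma(s),\gamma(t))^{-q}|\gamma'(s)||\gamma'(t)|\,ds\,dt$ with $r_{tp}(\gamma(s),\gamma(t))$ the radius of the circle through $\gamma(s),\gamma(t)$ tangent to $\gamma$ at $\gamma(s)$; $E_\vartheta=E+\vartheta\mathrm{TP}_q^{1/(q-2)}$. $\mathscr{C}(\mathcal{K})=\{\gamma\in W^{2,2}(\mathbb{R}/\mathbb{Z},\mathbb{R}^3):\mathscr{L}(\gamma)=1,|\gamma'|>0,\ \gamma\text{ embedded of knot type }\mathcal{K}\}$. A tame knot class is one containing a polygonal representative. (Such symmetric minimizers $\Gamma_\vartheta$ exist for every $\vartheta>0$ under the hypothesis.) $D_2$-symmetry: $R_1=\mathrm{diag}(1,-1,-1)$, $R_2=\mathrm{diag}(-1,1,-1)$, $R_3=\mathrm{diag}(-1,-1,1)$; on $\mathbb{R}/\mathbb{Z}$: $\psi_1(t)=-t+1/2$, $\psi_2(t)=t-1/2$, $\psi_3(t)=-t$. A curve $\gamma\in C^0(\mathbb{R}/\mathbb{Z},\mathbb{R}^3)$ of finite positive length is $D_2$-symmetric if $R_i\gamma(\psi_i(t))=\gamma(t)$ for all $t\in\mathbb{R}/\mathbb{Z}$, $i=1,2,3$. *)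

(* Defs.v *)
From HB Require Import structures.
From Stdlib Require Import ClassicalEpsilon.
From mathcomp Require Import all_boot all_order all_algebra.
From mathcomp Require Import all_classical all_reals all_analysis.
Set Implicit Arguments. Unset Strict Implicit. Unset Printing Implicit Defensive.
Import Order.TTheory GRing.Theory Num.Theory.
Import numFieldNormedType.Exports.
Local Open Scope classical_set_scope.
Local Open Scope ring_scope.

Section Knots.
Variable R : realType.

Definition V3 := 'rV[R]_3.

Definition comp (u : V3) (k : nat) : R := u 0 (inord k).

Definition dot3 (u v : V3) : R := \sum_(i < 3) u 0 i * v 0 i.
Definition enorm (u : V3) : R := Num.sqrt (dot3 u u).
Definition cross (u v : V3) : V3 :=
  \row_(i < 3) (comp u ((i + 1) %% 3) * comp v ((i + 2) %% 3)
              - comp u ((i + 2) %% 3) * comp v ((i + 1) %% 3)).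

Definition leb := (@lebesgue_measure R).
Definition I01 : set R := `[0%R, 1%R]%classic.

Definition vint (a b : R) (g : R -> V3) : V3 :=
  \row_(i < 3) Rintegral leb `[a, b]%classic (fun x => g x 0 i).

Definition periodic1 (f : R -> V3) := forall t, f (t + 1) = f t.

(* g is a weak second derivative of gamma on R/Z: gamma' is the integral of g,
   and g is square integrable on [0,1]. *)
Definition is_wdd (gamma g : R -> V3) : Prop :=
  periodic1 g /\
  (forall i : 'I_3, measurable_fun I01 (fun x => g x 0 i)) /\
  (\int[leb]_(x in I01) ((enorm (g x)) ^+ 2)%:E < +oo)%E /\
  (forall s t, s <= t -> derive1 gamma t - derive1 gamma s = vint s t g).

(* W^{2,2}(R/Z, R^3), represented by its C^1 representative on R (1-periodic). *)
Definition W22 (gamma : R -> V3) : Prop :=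
  periodic1 gamma /\ (forall t, derivable gamma t 1) /\ exists g, is_wdd gamma g.

(* A chosen weak second derivative (unique a.e.). *)
Definition d2 (gamma : R -> V3) : R -> V3 :=
  epsilon (inhabits (fun _ => 0)) (fun g => is_wdd gamma g).

Definition curve_length (gamma : R -> V3) : R :=
  Rintegral leb I01 (fun t => enorm (derive1 gamma t)).

Definition arclength (gamma : R -> V3) : Prop :=
  forall t, enorm (derive1 gamma t) = 1.

Definition kappa (gamma : R -> V3) (t : R) : R :=
  enorm (cross (derive1 gamma t) (d2 gamma t)) / (enorm (derive1 gamma t)) ^+ 3.

Definition bending (gamma : R -> V3) : \bar R :=
  (\int[leb]_(t in I01) ((kappa gamma t) ^+ 2 * enorm (derive1 gamma t))%:E)%E.

(* 1 / r_tp(gamma(s), gamma(t)): inverse radius of the circle through gamma(s),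
   gamma(t) tangent to gamma at gamma(s);  0 (infinite radius) when the points
   are collinear with the tangent, and 0 by convention when gamma(s) = gamma(t). *)
Definition inv_rtp (gamma : R -> V3) (s t : R) : R :=
  let d := gamma t - gamma s in
  if d == 0 then 0 else
  2 * enorm (cross (derive1 gamma s) d) /
    (enorm (derive1 gamma s) * (enorm d) ^+ 2).

Definition TP (q : R) (gamma : R -> V3) : \bar R :=
  (\int[leb]_(s in I01) \int[leb]_(t in I01)
     (powR (inv_rtp gamma s t) q * enorm (derive1 gamma s)
        * enorm (derive1 gamma t))%:E)%E.

Definition Etheta (q theta : R) (gamma : R -> V3) : \bar R :=
  (bending gamma + theta%:E * poweR (TP q gamma) (1 / (q - 2)))%E.

Definition injective_mod1 (gamma : R -> V3) :=
  forall s t, s \in I01 -> t \in I01 -> s < t -> gamma s = gamma t -> s = 0 /\ t = 1.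

Definition is_knot (K : set V3) : Prop :=
  exists gamma : R -> V3,
    continuous gamma /\ periodic1 gamma /\ injective_mod1 gamma /\ K = range gamma.

Definition ambient_isotopic (K1 K2 : set V3) : Prop :=
  exists H : R -> V3 -> V3,
    {within [set p : R * V3 | 0 <= p.1 <= 1], continuous (fun p => H p.1 p.2)} /\
    (forall x, H 0 x = x) /\
    (forall t, 0 <= t <= 1 ->
       exists Hi : V3 -> V3, continuous (H t) /\ continuous Hi /\
         cancel (H t) Hi /\ cancel Hi (H t)) /\
    H 1 @` K1 = K2.

Definition is_knot_class (KK : set (set V3)) : Prop :=
  exists K0, is_knot K0 /\ KK = [set K | is_knot K /\ ambient_isotopic K0 K].

Definition segment (a b : V3) : set V3 :=
  [set (1 - l) *: a + l *: b | l in I01].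

Definition is_polygonal_knot (K : set V3) : Prop :=
  is_knot K /\ exists ps : seq V3,
    K = \bigcup_(i in [set i : nat | (i < size ps)%N])
          segment (nth 0 ps i) (nth 0 ps ((i + 1) %% size ps)).

Definition tame (KK : set (set V3)) : Prop :=
  is_knot_class KK /\ exists P, KK P /\ is_polygonal_knot P.

Definition CK (KK : set (set V3)) (gamma : R -> V3) : Prop :=
  W22 gamma /\ curve_length gamma = 1 /\
  (forall t, 0 < enorm (derive1 gamma t)) /\
  injective_mod1 gamma /\ KK (range gamma).

Definition diag3 (a b c : R) (v : V3) : V3 :=
  \row_(i < 3) ([:: a; b; c]`_i * v 0 i).

Definition D2sym (gamma : R -> V3) : Prop :=
  continuous gamma /\ periodic1 gamma /\ 0 < curve_length gamma /\
  (forall t, diag3 1 (-1) (-1) (gamma (- t + 1/2)) = gamma t) /\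
  (forall t, diag3 (-1) 1 (-1) (gamma (t - 1/2)) = gamma t) /\
  (forall t, diag3 (-1) (-1) 1 (gamma (- t)) = gamma t).

Definition ip22 (u v : R -> V3) : R :=
  Rintegral leb I01 (fun t => dot3 (u t) (v t) + dot3 (derive1 u t) (derive1 v t)
                              + dot3 (d2 u t) (d2 v t)).

(* weak convergence in the Hilbert space W^{2,2} (via Riesz representation) *)
Definition weak_W22_cvg (G : nat -> R -> V3) (G0 : R -> V3) : Prop :=
  forall phi, W22 phi -> (fun k => ip22 (G k) phi) @ \oo --> ip22 G0 phi.

Definition C1_cvg (G : nat -> R -> V3) (G0 : R -> V3) : Prop :=
  forall eps : R, 0 < eps -> \forall k \near \oo, forall t,
    enorm (G k t - G0 t) < eps /\ enorm (derive1 (G k) t - derive1 G0 t) < eps.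

End Knots.

(* Main.v *)
Require Import Defs.
From HB Require Import structures.
From mathcomp Require Import all_boot all_order all_algebra.
From mathcomp Require Import all_classical all_reals all_analysis.
From mathcomp Require Import measurable_realfun.
From mathcomp Require Import ring lra.
Import Order.TTheory GRing.Theory Num.Theory.
Import numFieldNormedType.Exports.
Local Open Scope classical_set_scope.
Local Open Scope ring_scope.
Set Implicit Arguments. Unset Strict Implicit. Unset Printing Implicit Defensive.

(* For an arclength curve gamma' and gamma'' are orthogonal almost everywhere, so
   the bending energy is the squared L2 norm of gamma''. Comparing Gamma_j with
   Gamma_0, which has finite tangent-point energy, bounds this norm uniformly in j;
   the symmetry axes and the unit speed bound the curves and their tangents.

   Compactness is obtained along an ultrafilter finer than the sequence: the tangents
   converge pointwise, hence uniformly because a bound on the L2 norm of gamma'' makes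
   them equicontinuous, and the limit tangent has a density by Radon-Nikodym. Weak
   convergence of the second derivatives reduces to uniform convergence of difference
   quotients of the tangents, since the gap between the L2 form of the derivatives and
   that of the difference quotients is positive semidefinite and tends to 0. Weak lower
   semicontinuity and theta_j -> 0 then give the minimality of the limit.

   Finiteness of the tangent-point energy for q <= 4: an embedded regular curve is
   bi-Lipschitz, so 1/r_tp(s, s + h) is controlled by the variation of a primitive of
   |gamma''|_1 around s at scale |h|, divided by |h|. The fourth powers of these
   variations over dyadic scales are summable by a telescoping argument based on
   (p + q)^4 + (p - q)^4 = 2 p^4 + 12 p^2 q^2 + 2 q^4. *)

Local Notation locally_integrable := (locally_integrable [set: _]).

(** * Cauchy-Schwarz inequality *)

Section CauchySchwarz.
Context {R : realType}.

Lemma quadratic_ge0_sqr_le (a b c : R) : 0 <= c ->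
  (forall x, 0 <= a + 2 * x * b + x ^+ 2 * c) -> b ^+ 2 <= a * c.
Proof.
move=> c_ge0 q_ge0; pose p := Poly [:: a; 2 * b; c].
have p_ge0 x : 0 <= p.[x].
  by rewrite horner_Poly/=; apply: le_trans (q_ge0 x) _; lra.
have := @deg_le2_poly_delta_ge0 R p (size_Poly _); rewrite !coef_Poly/=.
by move=> /(_ c_ge0 p_ge0); lra.
Qed.

Context d (T : measurableType d) (mu : {measure set T -> \bar R}) (D : set T).
Hypothesis mD : measurable D.
Implicit Types f g : T -> R.

Lemma integrable_mul f g : measurable_fun D f -> measurable_fun D g ->
  mu.-integrable D (EFin \o (fun x => f x ^+ 2)) ->
  mu.-integrable D (EFin \o (fun x => g x ^+ 2)) ->
  mu.-integrable D (EFin \o (fun x => f x * g x)).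
Proof.
move=> mf mg if2 ig2.
apply: (le_integrable mD _ _ (integrableD mD if2 ig2)).
  by apply/measurable_EFinP; exact: measurable_funM.
move=> x _ /=; rewrite lee_fin normrM [leRHS]ger0_norm ?addr_ge0 ?sqr_ge0//.
rewrite -[f x ^+ 2]real_normK ?num_real// -[g x ^+ 2]real_normK ?num_real//.
by have := sqr_ge0 (`|f x| - `|g x|); have := normr_ge0 (f x);
  have := normr_ge0 (g x); nra.
Qed.

Lemma Rintegral_cauchy_schwarz f g :
  measurable_fun D f -> measurable_fun D g ->
  mu.-integrable D (EFin \o (fun x => f x ^+ 2)) ->
  mu.-integrable D (EFin \o (fun x => g x ^+ 2)) ->
  (\int[mu]_(x in D) (f x * g x)) ^+ 2 <=
  (\int[mu]_(x in D) (f x ^+ 2)) * (\int[mu]_(x in D) (g x ^+ 2)).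
Proof.
move=> mf mg if2 ig2; have ifg := integrable_mul mf mg if2 ig2.
apply: quadratic_ge0_sqr_le => [|k].
  by apply: Rintegral_ge0 => x _; exact: sqr_ge0.
have iZ r h : mu.-integrable D (EFin \o h) ->
    mu.-integrable D (EFin \o (fun x => r * h x)).
  by move=> ih; exact: eq_integrable (integrableZl mD r ih).
rewrite -!RintegralZl// -RintegralD//; last exact: iZ.
rewrite -RintegralD//; [|exact: eq_integrable (integrableD mD if2 (iZ _ _ ifg))|exact: iZ].
apply: Rintegral_ge0 => x _.
by rewrite (_ : _ + _ = (f x + k * g x) ^+ 2) ?sqr_ge0//; ring.
Qed.

Let integrable_one : (mu D < +oo)%E ->
  mu.-integrable D (EFin \o (fun=> (1 : R) ^+ 2)).
Proof.
move=> muD; apply/integrableP; split; first exact: measurable_cst.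
by rewrite /= integral_cst// expr1n normr1 mul1e.
Qed.

Lemma integrable_sqr f : (mu D < +oo)%E -> measurable_fun D f ->
  mu.-integrable D (EFin \o (fun x => f x ^+ 2)) ->
  mu.-integrable D (EFin \o f).
Proof.
move=> /integrable_one i1 mf if2.
have := integrable_mul mf (measurable_cst (1 : R)) if2 i1.
by apply: eq_integrable => // x _; rewrite /= mulr1.
Qed.

Lemma Rintegral_sqr_le f : (mu D < +oo)%E -> measurable_fun D f ->
  mu.-integrable D (EFin \o (fun x => f x ^+ 2)) ->
  (\int[mu]_(x in D) f x) ^+ 2 <=
  fine (mu D) * \int[mu]_(x in D) (f x ^+ 2).
Proof.
move=> muD mf if2; have i1 := integrable_one muD.
have := Rintegral_cauchy_schwarz mf (measurable_cst (1 : R)) if2 i1.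
have -> : \int[mu]_(x in D) ((cst (1 : R) x) ^+ 2) = fine (mu D).
  by rewrite -[RHS]mul1r -Rintegral_cst//; apply: eq_Rintegral => x _; rewrite expr1n.
by rewrite mulrC; under eq_Rintegral do rewrite mulr1.
Qed.

End CauchySchwarz.

(** * Locally integrable and periodic functions *)

Section LocallyIntegrable.
Context {R : realType}.
Notation mu := (@lebesgue_measure R).
Implicit Types (a b c k : R) (f g : R -> R).

Lemma locally_integrable_itv a b f : locally_integrable f ->
  mu.-integrable `[a, b] (EFin \o f).
Proof.
move=> [mf _ fK]; apply/integrableP; split.
  by apply/measurable_EFinP; exact: measurable_funTS.
by apply: fK => //; exact: segment_compact.
Qed.

Lemma itv_locally_integrable f :
  (forall n : nat, mu.-integrable `[- n%:R, n%:R] (EFin \o f)) ->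
  locally_integrable f.
Proof.
move=> f_int; split; [|exact: openT|move=> K _ cK].
- have -> : [set: R] = \bigcup_(n : nat) `[- n%:R, n%:R]%classic.
    apply/esym/seteqP; split=> // x _; exists (Num.truncn `|x|).+1 => //=.
    by rewrite in_itv/= -ler_norml ltW// truncnS_gt.
  apply/measurable_fun_bigcup => // n.
  by have /measurable_int/measurable_EFinP := f_int n.
- have [M [_ K_le]] := compact_bounded cK; pose n := (Num.truncn `|M|).+1.
  have M_lt : M < n%:R by rewrite (le_lt_trans (ler_norm _))// truncnS_gt.
  have /integrableP[mf] := f_int n; apply: le_lt_trans.
  apply: ge0_subset_integral => //.
  + exact: compact_measurable.
  + by apply/measurable_EFinP; apply: measurableT_comp => //; exact/measurable_EFinP.
  + by move=> x Kx; rewrite /= in_itv/= -ler_norml; exact: K_le Kx.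
Qed.

Lemma continuous_locally_integrable f : continuous f -> locally_integrable f.
Proof.
move=> cf; apply: itv_locally_integrable => n.
apply: continuous_compact_integrable; first exact: segment_compact.
exact: continuous_subspaceT.
Qed.

Lemma locally_integrableZ k f : locally_integrable f ->
  locally_integrable (fun x => k * f x).
Proof.
move=> f_int; apply: itv_locally_integrable => n.
apply: eq_integrable (integrableZl _ k (locally_integrable_itv _ _ f_int)) => //.
Qed.

Lemma Rintegral_itv_cat a b c f : a <= b -> b <= c -> locally_integrable f ->
  \int[mu]_(x in `[a, c]) f x =
  \int[mu]_(x in `[a, b]) f x + \int[mu]_(x in `[b, c]) f x.
Proof.
move=> ab bc f_int.
have := @Rintegral_itvB R f (BLeft a) (BRight c) b (locally_integrable_itv _ _ f_int).
rewrite !bnd_simp => /(_ ab bc) f_diff.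
apply/eqP; rewrite -subr_eq0 opprD addrA subr_eq0; apply/eqP.
rewrite [LHS]f_diff Rintegral_itv_obnd_cbnd//.
apply: integrableS (locally_integrable_itv b c f_int) => //.
by apply: subset_itv; rewrite bnd_simp.
Qed.

Lemma fine_lebesgue_measure_itv a b : a <= b -> fine (mu `[a, b]) = b - a.
Proof.
rewrite lebesgue_measure_itv/= lte_fin le_eqVlt => /predU1P[->|->//].
by rewrite ltxx subrr.
Qed.

Lemma Rintegral_itv_sqr_le a b f : a <= b ->
  measurable_fun setT f -> locally_integrable (fun x => f x ^+ 2) ->
  (\int[mu]_(x in `[a, b]) f x) ^+ 2 <=
  (b - a) * \int[mu]_(x in `[a, b]) (f x ^+ 2).
Proof.
move=> ab mf f2_int; rewrite -fine_lebesgue_measure_itv//.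
apply: Rintegral_sqr_le => //; last exact: locally_integrable_itv.
  exact/compact_finite_measure/segment_compact.
exact: measurable_funTS.
Qed.

Lemma measurable_shift c :
  measurable_fun setT ((fun x => x + c) : measurableTypeR R -> measurableTypeR R).
Proof.
apply: continuous_measurable_fun => x.
by apply: cvgD; [exact: cvg_id|exact: cvg_cst].
Qed.

Lemma itv_shift_preimage a b c (l r : bool) :
  (fun x => x + c) @^-1` [set` Interval (BSide l (a + c)) (BSide r (b + c))] =
  [set` Interval (BSide l a) (BSide r b)].
Proof.
by apply/seteqP; split=> x; case: l r => -[];
  rewrite /= !in_itv/= ?ltrD2r ?lerD2r.
Qed.

Lemma lebesgue_measure_shift c (A : set R) : measurable A ->
  pushforward mu ((fun x => x + c) : _ -> measurableTypeR R) A = mu A.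
Proof.
move=> mA; pose shift_mfun : {mfun measurableTypeR R >-> measurableTypeR R} :=
  HB.pack ((fun x => x + c) : measurableTypeR R -> measurableTypeR R)
   (isMeasurableFun.Build _ _ _ _ _ (measurable_shift c)).
apply/esym/(@lebesgue_measure_unique R (pushforward mu shift_mfun)) => //= _ [[a b]] _ <-.
rewrite /pushforward -[a](subrK c) -[b](subrK c) itv_shift_preimage.
rewrite !lebesgue_measure_itv/= !lte_fin ltrD2r; case: ifP => // _.
by congr (_%:E); ring.
Qed.

Lemma integrable_shift c (D : set R) f : measurable D ->
  mu.-integrable D (EFin \o f) ->
  mu.-integrable ((fun x => x + c) @^-1` D) (EFin \o (fun x => f (x + c))).
Proof.
move=> mD /integrableP[mf f_fin]; have mshift := measurable_shift c.
have mD' : measurable ((fun x : R => x + c) @^-1` D).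
  by rewrite -[X in measurable X]setTI; exact: mshift.
apply/integrableP; split.
  by apply: (measurable_comp mD _ mf) => [_ [x Dx <-]//|]; exact: measurable_funTS.
apply: le_lt_trans f_fin; rewrite le_eqVlt; apply/orP; left; apply/eqP.
have mnf : measurable_fun D (abse \o (EFin \o f)) by exact: measurableT_comp.
have := @ge0_integral_pushforward _ _ _ _ R _ mshift mu D _ mD mnf (fun y _ => abse_ge0 _).
move=> /= <-.
apply: eq_measure_integral => // A mA _; exact: lebesgue_measure_shift.
Qed.

Lemma locally_integrable_shift c f : locally_integrable f ->
  locally_integrable (fun x => f (x + c)).
Proof.
move=> f_int; apply: itv_locally_integrable => n.
rewrite -(itv_shift_preimage _ _ c); apply: integrable_shift => //.
exact: locally_integrable_itv.
Qed.

Lemma Rintegral_itv_shift a b c f : locally_integrable f ->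
  \int[mu]_(x in `[a + c, b + c]) f x = \int[mu]_(x in `[a, b]) f (x + c).
Proof.
move=> f_int; have [mf _ _] := f_int; rewrite /Rintegral; congr fine.
have mEf : measurable_fun setT (EFin \o f) by exact/measurable_EFinP.
have := @integral_pushforward _ _ _ _ R _ (measurable_shift c) mu
  `[a + c, b + c]%classic (EFin \o f) mEf.
rewrite itv_shift_preimage => <- //; last first.
  by apply: locally_integrable_itv; exact: locally_integrable_shift.
apply: eq_measure_integral => [|mc A mA _]; first exact: measurable_shift.
exact/esym/lebesgue_measure_shift.
Qed.

End LocallyIntegrable.

Lemma integrable_setU d (T : measurableType d) (R : realType)
    (mu : {measure set T -> \bar R}) (A B : set T) (f : T -> \bar R) :
  measurable A -> measurable B ->
  mu.-integrable A f -> mu.-integrable B f -> mu.-integrable (A `|` B) f.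
Proof.
move=> mA mB /integrableP[mfA fA] /integrableP[mfB fB].
have mfAB : measurable_fun (A `|` B) f by exact/measurable_funU.
have mBA : measurable (B `\` A) by exact: measurableD.
have mnf (C : set T) : C `<=` A `|` B -> measurable_fun C (fun x => `|f x|)%E.
  move=> CAB; apply: (measurable_funS (measurableU _ _ mA mB) CAB).
  exact: measurableT_comp.
apply/integrableP; split=> //.
rewrite (_ : A `|` B = A `|` (B `\` A)); last by rewrite setUDr setDv setD0.
rewrite ge0_integral_setU//; last 2 first.
- by rewrite setUDr setDv setD0; exact: mnf.
- by apply/disj_setPS => x [? []].
rewrite lte_add_pinfty//; apply: le_lt_trans fB.
by apply: ge0_subset_integral => //; exact/mnf/subsetUr.
Qed.

Section Periodic.
Context {R : realType}.
Notation mu := (@lebesgue_measure R).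
Implicit Types (a c t : R) (f : R -> R).

Definition frac t : R := t - (Num.floor t)%:~R.

Lemma frac_itv t : 0 <= frac t < 1.
Proof. by rewrite subr_ge0 floor_le ltrBlDl -intrD1 floorD1_gt. Qed.

Lemma periodic_frac : periodic frac 1.
Proof. by move=> t; rewrite /frac floorDrz// floor1 intrD1; ring. Qed.

Lemma frac_id t : 0 <= t < 1 -> frac t = t.
Proof. by move=> t01; rewrite /frac (floor_def (m := 0)) ?subr0// add0r. Qed.

Section PeriodicMap.
Context {V : zmodType} (f : R -> V).
Hypothesis f_per : periodic f 1.

Lemma periodic_intr t (m : int) : f (t + m%:~R) = f t.
Proof.
case: m => n; first exact: (periodicn f_per).
rewrite NegzE mulrNz -[in RHS](subrK n.+1%:~R t).
exact/esym/(periodicn f_per).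
Qed.

Lemma periodic_comp_frac t : f (frac t) = f t.
Proof. by rewrite /frac -rmorphN/= periodic_intr. Qed.

Lemma periodic_ind (P : V -> Prop) :
  (forall t, 0 <= t < 1 -> P (f t)) -> forall t, P (f t).
Proof. by move=> Pf t; rewrite -periodic_comp_frac; exact/Pf/frac_itv. Qed.

End PeriodicMap.

Lemma periodic_locally_integrable f : periodic f 1 ->
  mu.-integrable `[0, 1] (EFin \o f) -> locally_integrable f.
Proof.
move=> f_per f_int.
have unit_int (m : int) : mu.-integrable `[m%:~R, m%:~R + 1] (EFin \o f).
  have := @integrable_shift R (- m%:~R) `[0, 1]%classic f (measurable_itv _) f_int.
  rewrite -[X in `[X, 1]](subrr m%:~R) -[X in `[_, X]](addrK m%:~R) (addrC 1).
  rewrite itv_shift_preimage; congr (_.-integrable _ _).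
  by apply/funext => x; rewrite /= -rmorphN/= periodic_intr.
have itv_int (k : nat) (m : int) : mu.-integrable `[m%:~R, m%:~R + k%:R] (EFin \o f).
  elim: k => [|k k_int].
    rewrite addr0 set_itv1; apply/integrableP; split.
      exact: measurable_fun_set1.
    by rewrite integral_set1.
  apply: integrableS (integrable_setU _ _ k_int (unit_int (m + k))) => //.
    exact: measurableU.
  rewrite rmorphD/= -natr1 -pmulrn => x /=; rewrite !in_itv/= addrA.
  by case/andP => -> ->; case: leP; [left|right; rewrite ltW].
apply: itv_locally_integrable => n.
have := itv_int (n + n)%N (- n%:Z); rewrite rmorphN/= natrD addrA -pmulrn.
by rewrite addNr add0r.
Qed.

Lemma Rintegral_period a f : periodic f 1 -> locally_integrable f ->
  \int[mu]_(x in `[a, a + 1]) f x = \int[mu]_(x in `[0, 1]) f x.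
Proof.
move=> f_per f_int; have /andP[r_ge0 /ltW r_le1] := frac_itv a.
have -> : \int[mu]_(x in `[a, a + 1]) f x =
    \int[mu]_(x in `[frac a, frac a + 1]) f x.
  under [RHS]eq_Rintegral do rewrite -(periodic_intr f_per _ (Num.floor a)).
  by rewrite -Rintegral_itv_shift// /frac subrK addrAC subrK.
rewrite (Rintegral_itv_cat r_le1)//; last by rewrite lerDr.
rewrite -[X in `[X, frac a + 1]]add0r Rintegral_itv_shift//.
under [X in _ + X]eq_Rintegral do rewrite f_per.
by rewrite addrC -Rintegral_itv_cat.
Qed.

Lemma Rintegral_period_shift c f : periodic f 1 -> locally_integrable f ->
  \int[mu]_(x in `[0, 1]) f (x + c) = \int[mu]_(x in `[0, 1]) f x.
Proof.
by move=> f_per f_int; rewrite -Rintegral_itv_shift// add0r addrC Rintegral_period.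
Qed.

End Periodic.

(** * Square integrable functions and their primitives *)

Section ContinuousFunctions.
Context {R : realType}.
Implicit Types (f : R -> R).

Lemma continuous_exprn f n : continuous f -> continuous (fun x => f x ^+ n).
Proof.
move=> cf x; apply: (@continuous_comp _ _ _ f (fun y => y ^+ n)); first exact: cf.
exact: exprn_continuous.
Qed.

Lemma continuous_shift f c : continuous f -> continuous (fun x => f (x + c)).
Proof.
move=> cf x; apply: (@continuous_comp _ _ _ (fun y => y + c) f); last exact: cf.
by apply: continuousD; [exact: cvg_id|exact: cvg_cst].
Qed.

End ContinuousFunctions.

Section LocallyL2.
Context {R : realType}.
Notation mu := (@lebesgue_measure R).
Implicit Types (k : R) (f g u v : R -> R).

Definition locally_L2 f :=
  measurable_fun [set: R] f /\ locally_integrable (fun x => f x ^+ 2).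

Lemma continuous_locally_L2 f : continuous f -> locally_L2 f.
Proof.
move=> cf; split; first exact: continuous_measurable_fun.
exact/continuous_locally_integrable/continuous_exprn.
Qed.

Lemma locally_L2_integrable f : locally_L2 f -> locally_integrable f.
Proof.
move=> [mf f2_int]; apply: itv_locally_integrable => n; apply: integrable_sqr => //.
- exact/compact_finite_measure/segment_compact.
- exact: measurable_funTS.
- exact: locally_integrable_itv.
Qed.

Lemma locally_L2M f g : locally_L2 f -> locally_L2 g ->
  locally_integrable (fun x => f x * g x).
Proof.
move=> [mf f2_int] [mg g2_int]; apply: itv_locally_integrable => n.
by apply: integrable_mul => //; do [exact: measurable_funTS|exact: locally_integrable_itv].
Qed.

Lemma locally_L2D f g k : locally_L2 f -> locally_L2 g ->
  locally_L2 (fun x => f x + k * g x).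
Proof.
move=> f_L2 g_L2; have [[mf f2_int] [mg g2_int]] := (f_L2, g_L2).
split; first by apply: measurable_funD => //; exact: measurable_funM.
rewrite (_ : (fun x => (f x + k * g x) ^+ 2) =
  (fun x => f x ^+ 2) \+ ((fun x => (2 * k) * (f x * g x)) \+
    (fun x => k ^+ 2 * g x ^+ 2))); last by apply/funext => x /=; ring.
apply: locally_integrableD => //; apply: locally_integrableD.
  exact/locally_integrableZ/locally_L2M.
exact: locally_integrableZ.
Qed.

Lemma locally_L2Z k f : locally_L2 f -> locally_L2 (fun x => k * f x).
Proof.
move=> [mf f2_int]; split; first exact: measurable_funM.
by under eq_fun do rewrite exprMn; exact: locally_integrableZ.
Qed.

Lemma locally_L2_norm f : locally_L2 f -> locally_L2 (fun x => `|f x|).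
Proof.
move=> [mf f2_int]; split; first exact: measurableT_comp.
by under eq_fun do rewrite real_normK ?num_real//.
Qed.

Definition L2dot f g : R := \int[mu]_(x in `[0, 1]) (f x * g x).

Lemma L2dotC f g : L2dot f g = L2dot g f.
Proof. by apply: eq_Rintegral => x _; rewrite mulrC. Qed.

Lemma L2dot_sqr f : L2dot f f = \int[mu]_(x in `[0, 1]) (f x ^+ 2).
Proof. by apply: eq_Rintegral => x _; rewrite expr2. Qed.

Lemma EFin_L2dot_sqr f : locally_L2 f ->
  (L2dot f f)%:E = (\int[mu]_(x in `[0%R, 1%R]) (f x ^+ 2)%:E)%E.
Proof.
move=> [_ f2_int]; rewrite L2dot_sqr /Rintegral fineK//.
by apply: integrable_fin_num => //; exact: locally_integrable_itv.
Qed.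

Lemma L2dot_ge0 f : 0 <= L2dot f f.
Proof. by rewrite L2dot_sqr; apply: Rintegral_ge0 => x _; exact: sqr_ge0. Qed.

Lemma L2dotZ k f g : locally_L2 f -> locally_L2 g ->
  L2dot (fun x => k * f x) (fun x => k * g x) = k ^+ 2 * L2dot f g.
Proof.
move=> f_L2 g_L2; rewrite /L2dot -RintegralZl//.
  by apply: eq_Rintegral => x _; ring.
exact/locally_integrable_itv/locally_L2M.
Qed.

Lemma ge0_le_L2dot f g u v :
  (forall x, 0 <= f x <= u x) -> (forall x, 0 <= g x <= v x) ->
  locally_L2 f -> locally_L2 g -> locally_L2 u -> locally_L2 v ->
  L2dot f g <= L2dot u v.
Proof.
move=> fu gv f_L2 g_L2 u_L2 v_L2; apply: le_Rintegral => //.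
- exact/locally_integrable_itv/locally_L2M.
- exact/locally_integrable_itv/locally_L2M.
- by move=> x _; have /andP[? ?] := fu x; have /andP[? ?] := gv x; apply: ler_pM.
Qed.

Lemma L2dotDl f g u k : locally_L2 f -> locally_L2 g -> locally_L2 u ->
  L2dot (fun x => f x + k * g x) u = L2dot f u + k * L2dot g u.
Proof.
move=> f_L2 g_L2 u_L2.
have fu_int := locally_integrable_itv 0 1 (locally_L2M f_L2 u_L2).
have gu_int := locally_integrable_itv 0 1 (locally_L2M g_L2 u_L2).
have kgu_int := locally_integrable_itv 0 1 (locally_integrableZ k (locally_L2M g_L2 u_L2)).
rewrite /L2dot -RintegralZl// -RintegralD//.
by apply: eq_Rintegral => x _; ring.
Qed.

Lemma L2dot_sqrD f g k : locally_L2 f -> locally_L2 g ->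
  L2dot (fun x => f x + k * g x) (fun x => f x + k * g x) =
  L2dot f f + 2 * k * L2dot f g + k ^+ 2 * L2dot g g.
Proof.
move=> f_L2 g_L2; rewrite L2dotDl//; last exact: locally_L2D.
rewrite ![L2dot _ (fun x => _ + _)]L2dotC !L2dotDl// (L2dotC g f).
ring.
Qed.

Lemma L2dot_sqrD_le f g k : locally_L2 f -> locally_L2 g ->
  L2dot (fun x => f x + k * g x) (fun x => f x + k * g x) <=
  2 * (L2dot f f + k ^+ 2 * L2dot g g).
Proof.
move=> f_L2 g_L2; have := L2dot_ge0 (fun x => f x + - k * g x).
by rewrite !L2dot_sqrD// sqrrN; lra.
Qed.

Lemma L2dot_polar_le f g : locally_L2 f -> locally_L2 g ->
  2 * L2dot f g - L2dot g g <= L2dot f f.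
Proof.
move=> f_L2 g_L2; have := L2dot_ge0 (fun x => f x + -1 * g x).
by rewrite L2dot_sqrD//; lra.
Qed.

Lemma L2dot_cauchy_schwarz f g : locally_L2 f -> locally_L2 g ->
  L2dot f g ^+ 2 <= L2dot f f * L2dot g g.
Proof.
move=> [mf f2_int] [mg g2_int]; rewrite !L2dot_sqr.
by apply: Rintegral_cauchy_schwarz => //;
  do [exact: measurable_funTS|exact: locally_integrable_itv].
Qed.

End LocallyL2.

Section Primitive.
Context {R : realType}.
Notation mu := (@lebesgue_measure R).
Implicit Types (c h k s t : R) (f g A S T : R -> R).

Definition is_primitive T g := locally_integrable g /\
  forall s t, s <= t -> T t - T s = \int[mu]_(x in `[s, t]) g x.

Definition primitive f t : R :=
  if 0 <= t then \int[mu]_(x in `[0, t]) f x else - \int[mu]_(x in `[t, 0]) f x.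

Lemma primitiveP f : locally_integrable f -> is_primitive (primitive f) f.
Proof.
move=> f_int; split=> // s t st; rewrite /primitive; case: (leP 0 s) => s0.
  by rewrite (le_trans s0 st) (Rintegral_itv_cat s0 st)// addrAC subrr add0r.
rewrite opprK addrC; case: leP => t0; first by rewrite -Rintegral_itv_cat// ltW.
by rewrite (Rintegral_itv_cat st (ltW t0))// addrK.
Qed.

Lemma is_primitive_continuous T g : is_primitive T g -> continuous T.
Proof.
move=> [g_int Tg] x; pose F y := \int[mu]_(z in `[x - 1, y]) g z.
have x_in : x \in `](x - 1), (x + 1)[ by rewrite in_itv/=; apply/andP; split; lra.
have F_cont : {for x, continuous F}.
  apply: (@within_continuous_continuous R R R (x - 1) (x + 1)) => //; first lra.
  by apply: parameterized_integral_continuous; [lra|exact: locally_integrable_itv].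
have T_eq y : x - 1 <= y -> T y = T (x - 1) + F y.
  by rewrite /F => /Tg <-; rewrite addrC subrK.
have T_cvg : (fun y => T (x - 1) + F y) @ x --> T x.
  by rewrite [T x]T_eq; [apply: cvgD; [exact: cvg_cst|exact: F_cont]|lra].
apply: cvg_trans T_cvg; apply: near_eq_cvg; near=> y.
by rewrite -T_eq//; apply/ltW; near: y; apply: lt_nbhsr; lra.
Unshelve. all: by end_near. Qed.

Lemma is_primitive_norm_le T S f g s t :
  is_primitive S g -> is_primitive T f -> (forall x, `|g x| <= f x) -> s <= t ->
  `|S t - S s| <= T t - T s.
Proof.
move=> [g_int Sg] [f_int Tf] gf st; rewrite Sg// Tf//.
have g_st := locally_integrable_itv s t g_int.
apply: le_trans (le_normr_Rintegral _ g_st) _ => //.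
apply: le_Rintegral => //; last exact: locally_integrable_itv.
exact: (integrable_norm g_st).
Qed.

Lemma is_primitiveD T S f g k : is_primitive T f -> is_primitive S g ->
  is_primitive (fun x => T x + k * S x) (fun x => f x + k * g x).
Proof.
move=> [f_int Tf] [g_int Sg]; have kg_int := locally_integrableZ k g_int.
split; first exact: locally_integrableD.
move=> s t st; rewrite RintegralD//; try exact: locally_integrable_itv.
by rewrite RintegralZl ?locally_integrable_itv// -Tf// -Sg//; ring.
Qed.

Lemma is_primitive_periodicD1 T g s : is_primitive T g -> periodic g 1 ->
  T (s + 1) = T s + \int[mu]_(x in `[0, 1]) g x.
Proof.
move=> [g_int Tg] g_per; rewrite -(Rintegral_period s)// -Tg ?lerDl//.
by rewrite [RHS]addrC subrK.
Qed.

Lemma Rintegral_primitive_increment T g h : is_primitive T g -> periodic g 1 ->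
  \int[mu]_(s in `[0, 1]) (T (s + h) - T s) = h * \int[mu]_(x in `[0, 1]) g x.
Proof.
move=> Tg g_per; set c := \int[mu]_(x in _) g x; pose S s := T s - c * s.
have S_per : periodic S 1.
  by move=> s; rewrite /S (is_primitive_periodicD1 s Tg g_per) -/c; ring.
have S_int : locally_integrable S.
  apply: continuous_locally_integrable => s.
  apply: cvgB; first exact: (is_primitive_continuous Tg).
  by apply: cvgM; [exact: cvg_cst|exact: cvg_id].
have Sh_int := locally_integrable_shift h S_int.
have cst_int : locally_integrable (fun=> c * h).
  by apply: continuous_locally_integrable => s; exact: cvg_cst.
transitivity (\int[mu]_(s in `[0, 1]) (S (s + h) - S s + c * h)).
  by apply: eq_Rintegral => s _; rewrite /S; ring.
rewrite RintegralD//;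
  [|exact/locally_integrable_itv/locally_integrableB|exact: locally_integrable_itv].
rewrite RintegralB//; try exact: locally_integrable_itv.
rewrite Rintegral_period_shift// subrr add0r Rintegral_cst// fine_lebesgue_measure_itv//.
by rewrite subr0 mulr1 mulrC.
Qed.

Definition dquot h T s := (T (s + h) - T s) / h.

Lemma dquotD h T S k : dquot h (fun x => T x + k * S x) =
  (fun x => dquot h T x + k * dquot h S x).
Proof. by apply/funext => x; rewrite /dquot; ring. Qed.

Lemma dquot_continuous h T : continuous T -> continuous (dquot h T).
Proof.
move=> cT x; apply: cvgM; last exact: cvg_cst.
by apply: cvgB; [exact: continuous_shift|exact: cT].
Qed.

End Primitive.

Lemma limn_einf_gt {R : realType} (u : nat -> \bar R) (c : \bar R) :
  (c < limn_einf u)%E -> \forall n \near \oo, (c < u n)%E.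
Proof.
rewrite limn_einf_lim (cvg_lim (@ereal_hausdorff R) (@cvg_einfs_sup R _)).
move=> /ereal_sup_gt[_ [n _ <-] c_lt]; exists n => // k /= nk.
by apply: lt_le_trans c_lt _; apply: ereal_inf_lbound; exists k.
Qed.

Section L2Primitive.
Context {R : realType}.
Notation mu := (@lebesgue_measure R).
Implicit Types (c e h k s t x : R) (f g S T : R -> R).

Definition L2_primitive T g :=
  [/\ periodic g 1, locally_L2 g & is_primitive T g].

Lemma L2_primitive_continuous T g : L2_primitive T g -> continuous T.
Proof. by move=> [_ _]; exact: is_primitive_continuous. Qed.

Lemma locally_L2_dquot h T g : L2_primitive T g -> locally_L2 (dquot h T).
Proof.
by move=> /L2_primitive_continuous cT; exact/continuous_locally_L2/dquot_continuous.
Qed.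

Lemma L2_primitiveD T S g f k : L2_primitive T g -> L2_primitive S f ->
  L2_primitive (fun x => T x + k * S x) (fun x => g x + k * f x).
Proof.
move=> [g_per g_L2 Tg] [f_per f_L2 Sf]; split.
- by move=> x; rewrite g_per f_per.
- exact: locally_L2D.
- exact: is_primitiveD.
Qed.

Lemma L2_primitive_sqr_le T g s t : L2_primitive T g -> s <= t ->
  (T t - T s) ^+ 2 <= (t - s) * \int[mu]_(x in `[s, t]) (g x ^+ 2).
Proof. by move=> [_ [mg g2_int] [_ Tg]] st; rewrite Tg// Rintegral_itv_sqr_le. Qed.

Lemma L2_primitive_hoelder T g s t : L2_primitive T g -> `|t - s| <= 1 ->
  (T t - T s) ^+ 2 <= `|t - s| * L2dot g g.
Proof.
move=> Tg; wlog st : s t / s <= t => [wlog_st|].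
  have [st|/ltW ts ts1] := leP s t; first exact: wlog_st.
  by rewrite -sqrrN opprB distrC wlog_st// distrC.
rewrite ger0_norm ?subr_ge0// lerBlDl => ts1.
apply: le_trans (L2_primitive_sqr_le Tg st) _; have [g_per [_ g2_int] _] := Tg.
rewrite ler_wpM2l ?subr_ge0// L2dot_sqr.
have g2_per : periodic (fun x => g x ^+ 2) 1 by move=> x; rewrite g_per.
rewrite -(Rintegral_period s)// (Rintegral_itv_cat st ts1)// lerDl.
by apply: Rintegral_ge0 => x _; exact: sqr_ge0.
Qed.

Lemma L2dot_dquot_le T g h : L2_primitive T g -> 0 < h ->
  L2dot (dquot h T) (dquot h T) <= L2dot g g.
Proof.
move=> Tg h_gt0; have [g_per [mg g2_int] _] := Tg.
have g2_per : periodic (fun x => g x ^+ 2) 1 by move=> x; rewrite g_per.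
have A_prim := primitiveP g2_int; set A := primitive _ in A_prim.
have A_cont := is_primitive_continuous A_prim.
have [_ dqT2_int] := locally_L2_dquot h Tg.
have dA_int : locally_integrable (fun s => h^-1 * (A (s + h) - A s)).
  apply: locally_integrableZ; apply: locally_integrableB.
    exact/continuous_locally_integrable/continuous_shift.
  exact: continuous_locally_integrable.
have -> : L2dot g g = \int[mu]_(s in `[0, 1]) (h^-1 * (A (s + h) - A s)).
  rewrite RintegralZl//; last first.
    by apply: locally_integrable_itv; apply: locally_integrableB;
      apply: continuous_locally_integrable => //; exact: continuous_shift.
  by rewrite (Rintegral_primitive_increment _ A_prim)// mulKf ?gt_eqF// L2dot_sqr.
rewrite L2dot_sqr; apply: le_Rintegral => //; try exact: locally_integrable_itv.
move=> s _; have sh : s <= s + h by rewrite lerDl ltW.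
rewrite /dquot exprMn exprVn mulrC -ler_pdivlMl ?invr_gt0 ?exprn_gt0// invrK.
apply: le_trans (L2_primitive_sqr_le Tg sh) _.
by rewrite -A_prim.2// mulrA expr2 mulfK ?gt_eqF// addrAC subrr add0r.
Qed.

(* The defect L2dot g f - L2dot (dquot h T) (dquot h S) is a positive
   semidefinite form on pairs (T, g). *)
Lemma L2dot_dquot_cauchy_schwarz T S g f h :
  L2_primitive T g -> L2_primitive S f -> 0 < h ->
  (L2dot g f - L2dot (dquot h T) (dquot h S)) ^+ 2 <=
  L2dot g g * (L2dot f f - L2dot (dquot h S) (dquot h S)).
Proof.
move=> Tg Sf h_gt0; have [_ g_L2 _] := Tg; have [_ f_L2 _] := Sf.
have dqT_L2 := locally_L2_dquot h Tg; have dqS_L2 := locally_L2_dquot h Sf.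
apply: (@le_trans _ _ ((L2dot g g - L2dot (dquot h T) (dquot h T)) *
    (L2dot f f - L2dot (dquot h S) (dquot h S)))); last first.
  by rewrite ler_wpM2r ?subr_ge0 ?L2dot_dquot_le// gerBl L2dot_ge0.
apply: quadratic_ge0_sqr_le => [|k]; first by rewrite subr_ge0 L2dot_dquot_le.
have := L2dot_dquot_le (L2_primitiveD k Tg Sf) h_gt0.
rewrite dquotD !L2dot_sqrD// -subr_ge0; congr (0 <= _); ring.
Qed.

Lemma is_primitive_derive_ae T g : is_primitive T g ->
  {ae mu, forall x, is_derive x 1 T (g x)}.
Proof.
move=> [g_int Tg]; have := lebesgue_differentiation g_int.
apply: filterS; first exact: (ae_filter_ringOfSetsType mu).
move=> x x_leb.
pose F y := \int[mu]_(z in `[x - 1, y]) g z.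
have [F_der F'x] : derivable F x 1 /\ derive1 F x = g x.
  apply: (@FTC1_lebesgue_pt _ _ (BLeft (x - 1)) _ (x + 1)) => //; first lra.
  - exact: locally_integrable_itv.
  - rewrite lte_fin; lra.
apply: (@near_eq_is_derive _ _ _ (cst (T (x - 1)) \+ F)).
- near=> y; rewrite /F /= -Tg; first by rewrite addrC subrK.
  apply/ltW; near: y; apply: lt_nbhsr; lra.
- rewrite -[g x]add0r; apply: is_deriveD.
  by rewrite -F'x derive1E; exact/derivableP.
Unshelve. all: by end_near. Qed.

Lemma is_derive_dquot_cvg T x d : is_derive x 1 T d ->
  dquot n.+1%:R^-1 T x @[n --> \oo] --> d.
Proof.
move=> [T_der <-].
have inv_cvg : (forall n, n.+1%:R^-1 != 0 :> R) /\
    (fun n => n.+1%:R^-1 : R) @ \oo --> 0.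
  by split; [move=> n; rewrite invr_neq0|exact: cvg_harmonic].
have /cvgr_dnbhsP/(_ _ inv_cvg) := T_der; apply: cvg_trans.
apply: near_eq_cvg; apply: nearW => n.
by rewrite /dquot [RHS]mulrC (addrC x) /GRing.scale/= mulr1.
Qed.

Lemma dquot_cvg_ae T g : is_primitive T g ->
  {ae mu, forall x, dquot n.+1%:R^-1 T x @[n --> \oo] --> g x}.
Proof.
move=> /is_primitive_derive_ae.
apply: filterS; first exact: (ae_filter_ringOfSetsType mu).
by move=> x; exact: is_derive_dquot_cvg.
Qed.

(* Fatou's lemma along the difference quotients; g ^+ 2 need not be integrable. *)
Lemma L2dot_dquot_gt T g c : is_primitive T g ->
  (c%:E < \int[mu]_(x in `[0%R, 1%R]) (g x ^+ 2)%:E)%E ->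
  \forall n \near \oo, c < L2dot (dquot n.+1%:R^-1 T) (dquot n.+1%:R^-1 T).
Proof.
move=> Tg c_lt; have [[mg _ _] _] := Tg.
have dq_cont n : continuous (fun x => dquot n.+1%:R^-1 T x ^+ 2).
  exact/continuous_exprn/dquot_continuous/(is_primitive_continuous Tg).
pose E n x := (dquot n.+1%:R^-1 T x ^+ 2)%:E.
have mE n : measurable_fun (`[0, 1]%classic : set (measurableTypeR R)) (E n).
  apply/measurable_EFinP; apply: measurable_funTS.
  exact: continuous_measurable_fun.
have E_ge0 n x : (0 <= E n x)%E by rewrite lee_fin sqr_ge0.
have : (c%:E < limn_einf (fun n => \int[mu]_(x in `[0%R, 1%R]) E n x))%E.
  apply: lt_le_trans (fatou mu (measurable_itv _) mE (fun n x _ => E_ge0 n x)).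
  apply: (lt_le_trans c_lt); rewrite le_eqVlt; apply/orP; left; apply/eqP.
  apply: ae_eq_integral => //.
  - by apply/measurable_EFinP; apply: measurable_funTS; exact: measurable_funX.
  - apply: (emeasurable_fun_cvg (fun n x => einfs (E ^~ x) n)).
      exact: measurable_fun_einfs.
    by move=> x _; rewrite limn_einf_lim; exact: is_cvg_einfs.
  - have := dquot_cvg_ae Tg; apply: filterS; first exact: (ae_filter_ringOfSetsType mu).
    move=> x dq_cvg _; apply/esym/(cvg_limn_einf_sup _).1.
    apply: cvg_EFin; first exact: nearW.
    apply: (@cvg_comp _ _ _ _ (fun y => y ^+ 2) _ _ _ dq_cvg).
    exact: exprn_continuous.
move=> /limn_einf_gt; apply: filterS => n; rewrite -lte_fin L2dot_sqr.
rewrite /Rintegral fineK//; apply: integrable_fin_num => //.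
exact/locally_integrable_itv/continuous_locally_integrable.
Qed.

End L2Primitive.

(** * Weak convergence of weak derivatives *)

Lemma uniform_cvgP {R : realType} {J : Type} {U : choiceType} (F : set_system J)
    {FF : Filter F} (u : J -> U -> R) (v : U -> R) :
  {uniform, u @ F --> v} <->
  forall e : R, 0 < e -> \forall i \near F, forall t, `|u i t - v t| <= e.
Proof.
split=> [u_cvg e e_gt0|u_cvg P /uniform_nbhs[E [entE sEP]]].
  apply: (u_cvg [set w | forall t, `|w t - v t| <= e]).
  apply/uniform_nbhs; exists [set xy | ball xy.1 e xy.2]; split.
    by rewrite -entourage_ballE; exists e.
  by move=> w /= vw t; have /ltW := vw t Logic.I; rewrite distrC.
move: entE; rewrite -entourage_ballE => -[e /= e_gt0 sE].
apply: filterS (u_cvg (e / 2) _) => [i u_le|]; last by rewrite divr_gt0.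
apply: sEP => t _; apply: sE; rewrite /= /ball/= distrC.
by apply: le_lt_trans (u_le t) _; rewrite ltr_pdivrMr// ltr_pMr// ltr1n.
Qed.

Section WeakConvergence.
Context {R : realType} {J : Type} (F : set_system J) {FF : Filter F}.
Implicit Types (e h M : R) (f g v S : R -> R) (u w : J -> R -> R).

Lemma uniform_cvg_dquot u v h : h != 0 -> {uniform, u @ F --> v} ->
  {uniform, (fun j => dquot h (u j)) @ F --> dquot h v}.
Proof.
rewrite -normr_gt0 => h_gt0 /uniform_cvgP u_cvg; apply/uniform_cvgP => e e_gt0.
apply: filterS (u_cvg (e * `|h| / 2) _) => [j u_le t|]; last by rewrite !mulr_gt0// invr_gt0.
rewrite /dquot -mulrBl normrM normfV ler_pdivrMr//.
have -> : u j (t + h) - u j t - (v (t + h) - v t) =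
  (u j (t + h) - v (t + h)) - (u j t - v t) by ring.
apply: le_trans (ler_normB _ _) _.
by have := u_le (t + h); have := u_le t; lra.
Qed.

Lemma L2dot_cvg_uniform u v g : (forall j, continuous (u j)) -> continuous v ->
  locally_L2 g -> {uniform, u @ F --> v} -> L2dot (u j) g @[j --> F] --> L2dot v g.
Proof.
move=> u_cont v_cont g_L2 /uniform_cvgP u_cvg; apply/cvgrPdist_le => e e_gt0.
have c_gt0 : 0 < 1 + L2dot g g by rewrite ltr_pwDl ?L2dot_ge0.
have d_gt0 := divr_gt0 e_gt0 c_gt0; set d := e / _ in d_gt0.
apply: filterS (u_cvg d d_gt0) => j u_le.
have uL2 := continuous_locally_L2 (u_cont j); have vL2 := continuous_locally_L2 v_cont.
have duL2 := locally_L2D (-1) vL2 uL2.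
have du_le : L2dot (fun x => v x + -1 * u j x) (fun x => v x + -1 * u j x) <= d ^+ 2.
  rewrite L2dot_sqr; have <- : \int[@lebesgue_measure R]_(x in `[0, 1]) (d ^+ 2) = d ^+ 2.
    by rewrite Rintegral_cst// fine_lebesgue_measure_itv// subr0 mulr1.
  apply: le_Rintegral => //.
  - by case: duL2 => _ /locally_integrable_itv.
  - apply: locally_integrable_itv; apply: continuous_locally_integrable => x.
    exact: cvg_cst.
  - move=> x _; rewrite -real_normK ?num_real// lerXn2r ?nnegrE ?(ltW d_gt0)//.
    by rewrite mulN1r distrC.
have -> : L2dot v g - L2dot (u j) g = L2dot (fun x => v x + -1 * u j x) g.
  by rewrite L2dotDl// mulN1r.
rewrite -ler_sqr ?nnegrE ?(ltW e_gt0)// real_normK ?num_real//.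
apply: le_trans (L2dot_cauchy_schwarz duL2 g_L2) _.
apply: le_trans (ler_wpM2r (L2dot_ge0 g) du_le) _.
rewrite /d expr_div_n -mulrA ler_piMr ?sqr_ge0// mulrC ler_pdivrMr ?exprn_gt0// mul1r.
by have := L2dot_ge0 g; nra.
Qed.

Lemma L2dot_cvg_weak u w v f S g M :
  (forall j, L2_primitive (u j) (w j)) -> (forall j, L2dot (w j) (w j) <= M) ->
  L2_primitive v f -> L2_primitive S g -> {uniform, u @ F --> v} ->
  L2dot (w j) g @[j --> F] --> L2dot f g.
Proof.
move=> uw w_le vf Sg u_cvg; apply/cvgrPdist_le => e e_gt0.
have [_ f_L2 _] := vf; have [_ g_L2 S_prim] := Sg.
pose B := 2 * (`|M| + L2dot f f) + 1.
have B_gt0 : 0 < B by rewrite ltr_wpDl// mulr_ge0// addr_ge0// L2dot_ge0.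
pose d := (e / 2) ^+ 2 / B; have d_gt0 : 0 < d by rewrite divr_gt0// exprn_gt0// divr_gt0.
have /(L2dot_dquot_gt S_prim)/filter_ex[n] : ((L2dot g g - d)%:E <
    \int[@lebesgue_measure R]_(x in `[0%R, 1%R]) (g x ^+ 2)%:E)%E.
  by rewrite -EFin_L2dot_sqr// lte_fin ltrBlDr ltrDl.
set h := n.+1%:R^-1 => S_close; have h_gt0 : 0 < h by rewrite invr_gt0.
have dq_cvg : L2dot (dquot h (u j)) (dquot h S) @[j --> F] -->
    L2dot (dquot h v) (dquot h S).
  apply: L2dot_cvg_uniform.
  - by move=> j; exact/dquot_continuous/(L2_primitive_continuous (uw j)).
  - exact/dquot_continuous/(L2_primitive_continuous vf).
  - exact: locally_L2_dquot Sg.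
  - by apply: uniform_cvg_dquot => //; rewrite gt_eqF.
move/cvgrPdist_le : dq_cvg => /(_ (e / 2)); rewrite divr_gt0// => /(_ isT).
apply: filterS => j dq_le; have [_ w_L2 _] := uw j.
have defect_le := L2dot_dquot_cauchy_schwarz (L2_primitiveD (-1) (uw j) vf) Sg h_gt0.
rewrite dquotD (L2dotDl _ w_L2 f_L2 g_L2) (L2dotDl _ (locally_L2_dquot h (uw j))
  (locally_L2_dquot h vf) (locally_L2_dquot h Sg)) !mulN1r in defect_le.
set gap := _ - _ in dq_le; set defect := _ - _ - _ in defect_le.
have -> : L2dot f g - L2dot (w j) g = gap - defect by rewrite /gap /defect; ring.
apply: le_trans (ler_normB _ _) _; rewrite [leRHS]splitr lerD//.
rewrite -ler_sqr ?nnegrE ?divr_ge0 ?(ltW e_gt0)// real_normK ?num_real//.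
apply: (le_trans defect_le); rewrite -[leRHS](divfK (lt0r_neq0 B_gt0)) -/d mulrC.
apply: ler_pM; rewrite ?L2dot_ge0 ?subr_ge0//.
- by apply: L2dot_dquot_le.
- by rewrite lerBlDr -lerBlDl ltW.
- apply: le_trans (L2dot_sqrD_le _ w_L2 f_L2) _; rewrite sqrrN expr1n mul1r /B.
  by have := w_le j; have := ler_norm M; lra.
Qed.

End WeakConvergence.

(** * Weak limits along ultrafilters *)

Lemma fmap_ultra_filter {X Y : Type} (f : X -> Y) (F : set_system X) :
  UltraFilter F -> UltraFilter (f @ F).
Proof.
move=> UF; have PF : ProperFilter (f @ F) by exact: fmap_proper_filter.
split=> // G PG sG; apply/seteqP; split; last exact: sG.
move=> A GA; have [//|nA] := in_ultra_setVsetC (f @^-1` A) UF.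
have G0 : G set0 by rewrite -(setICr A); apply: filterI => //; exact: sG.
by have := filter_not_empty G G0.
Qed.

Lemma ultra_bounded_cvg {R : realType} {X : Type} (F : set_system X)
    (u : X -> R) (M : R) : UltraFilter F ->
  (forall j, `|u j| <= M) -> exists l : R, u @ F --> l.
Proof.
move=> UF u_le; have := @segment_compact R (- M) M; rewrite compact_ultra.
move=> /(_ (u @ F) (fmap_ultra_filter u UF))[|l [_ u_cvg]]; last by exists l.
by apply: (@filterE _ F) => j; rewrite /= in_itv/= -ler_norml.
Qed.

Section DominatedCharge.
Context d (T : measurableType d) (R : realType) (mu : {measure set T -> \bar R}).
Variables (D : set T) (nu : set T -> R) (C : R).
Hypotheses (mD : measurable D) (muD : (mu D < +oo)%E).
Hypothesis nuU : forall A B, measurable A -> measurable B -> A `&` B = set0 ->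
  nu (A `|` B) = nu A + nu B.
Hypothesis nu_sqr_le : forall A, measurable A ->
  nu A ^+ 2 <= fine (mu (A `&` D)) * C.

Lemma dominated_charge0 : nu set0 = 0.
Proof.
have := nu_sqr_le measurable0; rewrite set0I measure0 mul0r => nu_le0.
by apply/eqP; rewrite -sqrf_eq0 eq_le nu_le0 sqr_ge0.
Qed.

Let nu_bigsetU (A : nat -> set T) n : (forall i, measurable (A i)) ->
  trivIset setT A -> nu (\big[setU/set0]_(i < n) A i) = \sum_(i < n) nu (A i).
Proof.
move=> mA tA; elim: n => [|n IH]; first by rewrite !big_ord0 dominated_charge0.
rewrite !big_ord_recr/= nuU ?IH//; first exact: bigsetU_measurable.
apply: (@trivIset_bigsetUI _ predT A _ n n) => //.
by move=> i j _ _; exact: tA.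
Qed.

Let mu_tail_cvg0 (A : nat -> set T) : (forall i, measurable (A i)) ->
  mu ((\bigcup_i A i `\` \big[setU/set0]_(i < n) A i) `&` D) @[n --> \oo] --> 0%E.
Proof.
move=> mA; pose t n := (\bigcup_i A i `\` \big[setU/set0]_(i < n) A i) `&` D.
have mt n : measurable (t n).
  by apply: measurableI => //; apply: measurableD;
    [exact: bigcup_measurable|exact: bigsetU_measurable].
have cap_t : \bigcap_n t n = set0.
  rewrite -subset0 => x tx; have [[[i _ Aix] _] _] := tx 0%N Logic.I.
  have [[_ nx] _] := tx i.+1 Logic.I; apply: nx.
  by rewrite -bigcup_mkord; exists i => /=.
have := @nonincreasing_cvg_mu _ _ _ mu t; rewrite cap_t measure0; apply=> //.
- apply: le_lt_trans muD; apply: le_measure; rewrite ?inE//; exact: subIsetr.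
- move=> n m nm; apply/subsetPset; apply: setSI; apply: setDS.
  by rewrite -!bigcup_mkord; apply: bigcup_subset => i /= /leq_trans; apply.
Qed.

Lemma dominated_charge_semi_sigma_additive :
  semi_sigma_additive (fun A => (nu A)%:E).
Proof.
move=> A mA tA mU; have mS n : measurable (\big[setU/set0]_(i < n) A i).
  exact: bigsetU_measurable.
under eq_fun do rewrite big_mkord sumEFin -nu_bigsetU//.
apply: cvg_EFin; first exact: nearW.
apply/cvgrPdist_lt => e e_gt0; have C_gt0 : 0 < `|C| + 1 by rewrite ltr_wpDl.
have := mu_tail_cvg0 mA => /fine_cvg/cvgrPdist_lt/(_ (e ^+ 2 / (`|C| + 1))).
rewrite divr_gt0 ?exprn_gt0// => /(_ isT); apply: filterS => n.
rewrite sub0r normrN ger0_norm ?fine_ge0// ltr_pdivlMr//=.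
set S := \big[setU/set0]_(i < n) A i; set t := _ `\` S => mu_lt.
have sub : S `<=` \bigcup_i A i by rewrite /S -bigcup_mkord => x [i _ Ax]; exists i.
have mt : measurable t by exact: (measurableD mU (mS n)).
have -> : nu (\bigcup_i A i) - nu S = nu t.
  rewrite -{1}(setDUK sub) nuU//; [by rewrite addrAC subrr add0r|exact: mS|].
  by rewrite setDE setICA setICr setI0.
rewrite -ltr_sqr ?nnegrE ?(ltW e_gt0)// real_normK ?num_real//.
apply: le_lt_trans (nu_sqr_le mt) _; apply: le_lt_trans mu_lt.
by rewrite ler_wpM2l ?fine_ge0// (le_trans (ler_norm _))// lerDl.
Qed.

End DominatedCharge.

Section UltraWeakLimit.
Context d (T : measurableType d) (R : realType)
  (mu : {sigma_finite_measure set T -> \bar R}) {X : Type}.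
Variables (D : set T) (U : set_system X) (g : X -> T -> R) (M : R).
Hypotheses (mD : measurable D) (muD : (mu D < +oo)%E) (UU : UltraFilter U).
Hypothesis mg : forall j, measurable_fun D (g j).
Hypothesis g2_int : forall j, mu.-integrable D (EFin \o (fun x => g j x ^+ 2)).
Hypothesis g2_le : forall j, \int[mu]_(x in D) (g j x ^+ 2) <= M.

Let PU : ProperFilter U := ultra_proper.

Let set_integral A j : R := \int[mu]_(x in A `&` D) g j x.

Let mAD A : measurable A -> measurable (A `&` D).
Proof. by move=> mA; exact: measurableI. Qed.

Let muAD A : measurable A -> (mu (A `&` D) <= mu D)%E.
Proof. by move=> mA; apply: le_measure; rewrite ?inE//; exact: mAD. Qed.

Let g_int A j : measurable A -> mu.-integrable (A `&` D) (EFin \o g j).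
Proof.
by move=> mA; apply: integrableS (integrable_sqr mD muD (mg j) (g2_int j)) => //;
  exact: mAD.
Qed.

Let set_integral_sqr_le A j : measurable A ->
  set_integral A j ^+ 2 <= fine (mu (A `&` D)) * M.
Proof.
move=> mA; have g2_intA : mu.-integrable (A `&` D) (EFin \o (fun x => g j x ^+ 2)).
  by apply: integrableS (g2_int j) => //; exact: mAD.
apply: le_trans (Rintegral_sqr_le (mAD mA) _ _ g2_intA) _.
- exact: le_lt_trans (muAD mA) muD.
- by apply: measurable_funS (mg j).
rewrite ler_wpM2l ?fine_ge0//; apply: le_trans (g2_le j).
rewrite /Rintegral fine_le//.
- by apply: integrable_fin_num => //; exact: mAD.
- exact: (integrable_fin_num mD (g2_int j)).
- apply: ge0_subset_integral => //; first exact: mAD.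
  + exact: measurable_int (g2_int j).
  + by move=> x _; rewrite lee_fin sqr_ge0.
Qed.

Let set_integral_cvg A : measurable A -> exists l : R, set_integral A @ U --> l.
Proof.
move=> mA; pose B := fine (mu (A `&` D)) * M + 1.
apply: (@ultra_bounded_cvg _ _ _ _ B) => j.
have : `|set_integral A j| ^+ 2 <= fine (mu (A `&` D)) * M.
  by rewrite real_normK ?num_real// set_integral_sqr_le.
by rewrite /B; have := normr_ge0 (set_integral A j); nra.
Qed.

Let limit A : R := lim (set_integral A @ U).

Let limit_cvg A : measurable A -> set_integral A @ U --> limit A.
Proof.
by move=> /set_integral_cvg[l Al]; rewrite /limit (cvg_lim _ Al)//; exact: Rhausdorff.
Qed.

Let limit_sqr_le A : measurable A -> limit A ^+ 2 <= fine (mu (A `&` D)) * M.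
Proof.
move=> mA; apply: (@cvgr_to_le _ U PU _ (fun j => set_integral A j ^+ 2)).
  rewrite expr2; under eq_fun do rewrite expr2.
  by apply: cvgM; exact: limit_cvg.
by apply: nearW => j; exact: set_integral_sqr_le.
Qed.

Let limitU A B : measurable A -> measurable B -> A `&` B = set0 ->
  limit (A `|` B) = limit A + limit B.
Proof.
move=> mA mB AB0; apply: (@cvg_unique _ (@Rhausdorff R) (set_integral (A `|` B) @ U)).
  by apply: limit_cvg; exact: measurableU.
rewrite (_ : set_integral _ = fun j => set_integral A j + set_integral B j).
  by apply: cvgD; exact: limit_cvg.
apply/funext => j; rewrite /set_integral setIUl Rintegral_setU//; try exact: mAD.
  by rewrite -setIUl; apply: g_int; exact: measurableU.
by apply/disj_setPS => x [[Ax _] [Bx _]]; rewrite -AB0.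
Qed.

Let limit_charge (A : set T) : \bar R := (limit A)%:E.

Let limit_charge0 : limit_charge set0 = 0%E.
Proof. by rewrite /limit_charge (dominated_charge0 limit_sqr_le). Qed.

Let limit_charge_fin A : measurable A -> limit_charge A \is a fin_num.
Proof. by []. Qed.

Let limit_charge_sigma : semi_sigma_additive limit_charge :=
  dominated_charge_semi_sigma_additive mD muD limitU limit_sqr_le.

HB.instance Definition _ := isCharge.Build _ _ _ limit_charge
  limit_charge0 limit_charge_fin limit_charge_sigma.

(* The limit is the Radon-Nikodym density of the limits of the integrals over
   measurable sets. *)
Lemma ultra_weak_limit : exists2 f : T -> R, mu.-integrable D (EFin \o f) &
  forall A, measurable A -> A `<=` D ->
    \int[mu]_(x in A) g j x @[j --> U] --> \int[mu]_(x in A) f x.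
Proof.
pose nu : {charge set T -> \bar R} := limit_charge.
have nu_mu : nu `<< mu.
  apply/null_content_dominatesP => A mA A0; rewrite /= /limit_charge; congr EFin.
  have := limit_sqr_le mA; rewrite (_ : mu (A `&` D) = 0%E).
    by rewrite mul0r => nuA; apply/eqP; rewrite -sqrf_eq0 eq_le nuA sqr_ge0.
  apply/eqP; rewrite eq_le measure_ge0 andbT -A0.
  by apply: le_measure; rewrite ?inE//; exact: mAD.
have nuE x : (fine (Radon_Nikodym nu mu x))%:E = Radon_Nikodym nu mu x.
  by rewrite fineK//; exact: Radon_Nikodym_fin_num.
exists (fine \o Radon_Nikodym nu mu).
  rewrite (_ : EFin \o _ = Radon_Nikodym nu mu); last exact/funext.
  exact: integrableS (Radon_Nikodym_integrable nu_mu).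
move=> A mA AD; have -> : \int[mu]_(x in A) (fine \o Radon_Nikodym nu mu) x = limit A.
  rewrite /Rintegral; under eq_integral do rewrite /= nuE.
  by rewrite -Radon_Nikodym_integral.
by have := limit_cvg mA; rewrite /set_integral setIidl.
Qed.

End UltraWeakLimit.

(** * Ultrafilter compactness of the periodic Sobolev space *)

Section UniformLimit.
Context {R : realType} {J : Type} (F : set_system J) {PF : ProperFilter F}.
Implicit Types (C M : R) (v f : R -> R) (u w : J -> R -> R).

Lemma periodic_pointwise_limit u v : (forall j, periodic (u j) 1) ->
  (forall t, u j t @[j --> F] --> v t) -> periodic v 1.
Proof.
move=> u_per uv t; have ut : u ^~ (t + 1) = u ^~ t by apply/funext => j; exact: u_per.
by apply: (cvg_unique (@Rhausdorff R) (uv (t + 1))); rewrite ut; exact: uv.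
Qed.

Lemma periodic_pointwise_uniform_cvg u v C :
  (forall j, periodic (u j) 1) -> (forall t, u j t @[j --> F] --> v t) ->
  (forall j s t, `|t - s| <= 1 -> (u j t - u j s) ^+ 2 <= `|t - s| * C) ->
  {uniform, u @ F --> v}.
Proof.
move=> u_per uv u_mod; apply/uniform_cvgP => e e_gt0.
have e3_gt0 : 0 < e / 3 by rewrite divr_gt0.
have v_per := periodic_pointwise_limit u_per uv.
have v_mod s t : `|t - s| <= 1 -> (v t - v s) ^+ 2 <= `|t - s| * C.
  move=> ts; apply: (@cvgr_to_le _ F PF _ (fun j => (u j t - u j s) ^+ 2)).
    by rewrite expr2; under eq_fun do rewrite expr2; apply: cvgM; exact: cvgB.
  by apply: nearW => j; exact: u_mod.
pose N := (Num.truncn (`|C| / (e / 3) ^+ 2)).+1; pose grid (a : 'I_N) : R := a%:R / N%:R.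
have N_gt0 : 0 < N%:R :> R by rewrite ltr0n.
have C_le : `|C| <= (e / 3) ^+ 2 * N%:R.
  by rewrite mulrC -ler_pdivrMr ?exprn_gt0// ltW// truncnS_gt.
have : \forall j \near F, forall a, `|v (grid a) - u j (grid a)| <= e / 3.
  by apply: filter_forall => a; have /cvgrPdist_le := uv (grid a); exact.
apply: filterS => j u_grid t; have /andP[r_ge0 r_lt1] := frac_itv t.
rewrite -(periodic_comp_frac (u_per j)) -(periodic_comp_frac v_per).
move: (frac t) r_ge0 r_lt1 => r r_ge0 r_lt1.
have rN_ge0 : 0 <= r * N%:R by rewrite mulr_ge0.
have /andP[a_le a_gt] := truncn_itv rN_ge0.
have a_lt : (Num.truncn (r * N%:R) < N)%N.
  by rewrite -(@ltr_nat R) (le_lt_trans a_le)// gtr_pMl.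
pose s := grid (Ordinal a_lt); have s_le : s <= r by rewrite ler_pdivrMr.
have rs_le : r - s <= N%:R^-1.
  by rewrite lerBlDl -[X in _ + X]mul1r -mulrDl natr1 ler_pdivlMr// ltW.
have rs_norm : `|r - s| = r - s by rewrite ger0_norm ?subr_ge0.
have rs_le1 : `|r - s| <= 1.
  by rewrite rs_norm (le_trans rs_le)// invf_le1// ler1n.
have near_grid x : x ^+ 2 <= `|r - s| * C -> `|x| <= e / 3.
  move=> x_le; rewrite -ler_sqr ?nnegrE ?(ltW e3_gt0)// real_normK ?num_real//.
  apply: (le_trans x_le); apply: (@le_trans _ _ (`|r - s| * `|C|)).
    by rewrite ler_wpM2l// ler_norm.
  rewrite rs_norm -[leRHS](mulfK (lt0r_neq0 N_gt0)) mulrC.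
  by rewrite ler_pM ?subr_ge0.
have -> : u j r - v r = (u j r - u j s) - (v s - u j s) - (v r - v s) by ring.
have := near_grid _ (u_mod j s r rs_le1); have := near_grid _ (v_mod s r rs_le1).
have := u_grid (Ordinal a_lt); rewrite -/s => gap_s gap_v gap_u.
have := ler_normB (u j r - u j s - (v s - u j s)) (v r - v s).
by have := ler_normB (u j r - u j s) (v s - u j s); lra.
Qed.

Lemma uniform_cvg_pointwise u v t : {uniform, u @ F --> v} -> u j t @[j --> F] --> v t.
Proof.
move=> /uniform_cvgP u_cvg; apply/cvgrPdist_le => e /u_cvg.
by apply: filterS => j; rewrite distrC.
Qed.

Lemma L2dot_uniform_limit_le u v M : (forall j, continuous (u j)) -> continuous v ->
  {uniform, u @ F --> v} -> (forall j, L2dot (u j) (u j) <= M) -> L2dot v v <= M.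
Proof.
move=> u_cont v_cont u_cvg u_le; have v_L2 := continuous_locally_L2 v_cont.
have uv_cvg := L2dot_cvg_uniform u_cont v_cont v_L2 u_cvg.
rewrite -[L2dot v v](addrK (L2dot v v)) -mulr2n -mulr_natl.
apply: (@cvgr_to_le _ F PF _ (fun j => 2 * L2dot (u j) v - L2dot v v)).
  by apply: cvgB; [apply: cvgM; [exact: cvg_cst|exact: uv_cvg]|exact: cvg_cst].
apply: nearW => j; apply: le_trans (u_le j); apply: L2dot_polar_le => //.
exact: continuous_locally_L2.
Qed.

Lemma L2_primitive_uniform_limit u w v f M :
  (forall j, L2_primitive (u j) (w j)) -> (forall j, L2dot (w j) (w j) <= M) ->
  {uniform, u @ F --> v} -> periodic f 1 -> is_primitive v f -> L2_primitive v f.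
Proof.
move=> uw w_le u_cvg f_per vf; split=> //; have [[mf _ _] _] := vf; split=> //.
have v_cont := is_primitive_continuous vf.
have dquot_le n : L2dot (dquot n.+1%:R^-1 v) (dquot n.+1%:R^-1 v) <= M.
  have n_gt0 : 0 < n.+1%:R^-1 :> R by rewrite invr_gt0.
  apply: (@L2dot_uniform_limit_le (fun j => dquot n.+1%:R^-1 (u j))).
  - by move=> j; exact/dquot_continuous/(L2_primitive_continuous (uw j)).
  - exact: dquot_continuous.
  - by apply: uniform_cvg_dquot => //; rewrite gt_eqF.
  - by move=> j; apply: le_trans (w_le j); exact: L2dot_dquot_le.
apply: periodic_locally_integrable; first by move=> x; rewrite f_per.
apply/integrableP; split.
  by apply/measurable_EFinP; apply: measurable_funTS; exact: measurable_funX.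
under eq_integral do rewrite /= ger0_norm ?sqr_ge0//.
apply: (@le_lt_trans _ _ M%:E); last exact: ltry.
rewrite leNgt; apply/negP => /(L2dot_dquot_gt vf)/filter_ex[n].
by rewrite ltNge dquot_le.
Qed.

End UniformLimit.

Section PeriodicExtension.
Context {R : realType}.
Notation mu := (@lebesgue_measure R).
Implicit Types (f T : R -> R).

Let integrable_frac f : mu.-integrable `[0, 1] (EFin \o f) ->
  mu.-integrable `[0, 1] (EFin \o (f \o frac)).
Proof.
move=> f_int; have f_int01 : mu.-integrable `[0, 1[ (EFin \o f).
  by apply: integrableS f_int => //; apply: subset_itv; rewrite bnd_simp.
have frac_int01 : mu.-integrable `[0, 1[ (EFin \o (f \o frac)).
  apply: eq_integrable f_int01 => // x.
  by rewrite inE/= in_itv/= => x01; rewrite frac_id.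
have frac_int1 : mu.-integrable [set 1] (EFin \o (f \o frac)).
  by apply/integrableP; split; [exact: measurable_fun_set1|rewrite integral_set1].
by rewrite -(@setUitv1 _ _ (BLeft 0) _ true) ?bnd_simp//; exact: integrable_setU.
Qed.

Lemma primitive_periodic_extension T f : periodic T 1 ->
  mu.-integrable `[0, 1] (EFin \o f) ->
  (forall s t, 0 <= s -> s <= t -> t <= 1 -> T t - T s = \int[mu]_(x in `[s, t]) f x) ->
  exists2 g, periodic g 1 & is_primitive T g.
Proof.
move=> T_per f_int Tf; pose g := f \o frac.
have g_per : periodic g 1 by move=> x; rewrite /g /= periodic_frac.
have g_int := periodic_locally_integrable g_per (integrable_frac f_int).
have g_itv v : 0 <= v < 1 -> \int[mu]_(x in `[0, v]) g x = T v - T 0.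
  move=> /andP[v_ge0 v_lt1]; rewrite Tf// ?ltW//; apply: eq_Rintegral => x.
  rewrite inE/= in_itv/= => /andP[x_ge0 xv].
  by rewrite /g/= frac_id// x_ge0 (le_lt_trans xv).
have g01 : \int[mu]_(x in `[0, 1]) g x = 0.
  have int_co h : mu.-integrable `[0, 1] (EFin \o h) -> mu.-integrable `[0, 1[ (EFin \o h).
    by apply: integrableS => //; apply: subset_itv; rewrite bnd_simp.
  rewrite -Rintegral_itv_bndo_bndc; last exact/int_co/integrable_frac.
  transitivity (\int[mu]_(x in `[0, 1[) f x).
    by apply: eq_Rintegral => x; rewrite inE/= in_itv/= => x01; rewrite /g/= frac_id.
  rewrite Rintegral_itv_bndo_bndc; last exact: int_co.
  by rewrite -Tf// -[1]add0r T_per subrr.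
have P_prim := primitiveP g_int; set P := primitive g in P_prim.
have TP_per : periodic (fun t => T t - P t) 1.
  by move=> t; rewrite T_per (is_primitive_periodicD1 _ P_prim)// g01 addr0.
have TP_cst : forall t, T t - P t = T 0.
  apply: (periodic_ind (P := fun y => y = T 0) TP_per) => t t01; rewrite /P /primitive.
  by have /andP[-> _] := t01; rewrite g_itv// opprB addrC subrK.
exists g => //; split=> // s t st; rewrite -(P_prim.2 _ _ st).
by have := TP_cst t; have := TP_cst s; lra.
Qed.

End PeriodicExtension.

Section Sobolev22.
Context {R : realType}.
Implicit Types (C M h s t : R) (f g u v : R -> R).

(* A function in W^{2,2}(R/Z) together with its weak second derivative. *)
Definition sobolev22 u g :=
  [/\ periodic u 1, (forall t, derivable u t 1) & L2_primitive (derive1 u) g].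

Lemma derivable_continuous u : (forall t, derivable u t 1) -> continuous u.
Proof.
by move=> du t; apply: differentiable_continuous; exact/derivable1_diffP.
Qed.

Lemma periodic_derive1 (V : normedModType R) (w : R -> V) :
  periodic w 1 -> periodic (derive1 w) 1.
Proof.
move=> w_per t; rewrite /derive1.
rewrite (_ : (fun h => _) = (fun h => h^-1 *: (w (h + t) - w t)))//.
by apply/funext => h; rewrite addrA !w_per.
Qed.

Lemma MVT_increment u t h : (forall x, derivable u x 1) ->
  exists2 c, `|c - t| <= `|h| & u (t + h) - u t = h * derive1 u c.
Proof.
move=> du; have mvt a b : a <= b ->
    exists2 c, a <= c <= b & u b - u a = (b - a) * derive1 u c.
  move=> ab; have [x _||c] := @MVT_segment R u (derive1 u) a b ab.
  - by rewrite derive1E; exact/derivableP.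
  - exact/continuous_subspaceT/derivable_continuous.
  - by rewrite in_itv/= mulrC; exists c.
have [h_ge0|h_lt0] := leP 0 h.
  have [|c /andP[tc cth] ->] := mvt t (t + h); first by rewrite lerDl.
  exists c; last by rewrite addrAC subrr add0r.
  by rewrite !ger0_norm ?subr_ge0// lerBlDl.
have [|c /andP[thc ct] u_diff] := mvt (t + h) t; first by rewrite gerDl ltW.
exists c; last by rewrite -opprB u_diff; ring.
by rewrite distrC ger0_norm ?subr_ge0// ltr0_norm//; lra.
Qed.

Lemma sobolev22_taylor u g t h : sobolev22 u g -> `|h| <= 1 ->
  (u (t + h) - u t - h * derive1 u t) ^+ 2 <= `|h| ^+ 3 * L2dot g g.
Proof.
move=> [_ du du_prim] h_le1; have [c ch ->] := MVT_increment t h du.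
have := L2_primitive_hoelder du_prim (le_trans ch h_le1).
rewrite -mulrBr exprMn -[h ^+ 2]real_normK ?num_real// [_ ^+ 3]exprSr -mulrA => du_le.
apply: ler_wpM2l; first exact: sqr_ge0.
by apply: le_trans du_le _; rewrite ler_wpM2r// L2dot_ge0.
Qed.

Lemma is_derive_taylor_remainder u t d C :
  (forall h, `|h| <= 1 -> (u (t + h) - u t - h * d) ^+ 2 <= `|h| ^+ 3 * C) ->
  is_derive t 1 u d.
Proof.
move=> rem_le.
have quot_cvg : (fun h => h^-1 *: ((u \o shift t) (h *: 1) - u t)) @ 0^' --> d.
  apply/cvgrPdist_le => e e_gt0; near=> h.
  have h_neq0 : h != 0 by near: h; exact: nbhs_dnbhs_neq.
  have h_le1 : `|h| <= 1 by near: h; apply: dnbhs0_le.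
  have h_small : `|h| <= e ^+ 2 / (`|C| + 1).
    by near: h; apply: dnbhs0_le; rewrite divr_gt0 ?exprn_gt0// ltr_wpDl.
  have h2_gt0 : 0 < `|h| ^+ 2 by rewrite exprn_gt0// normr_gt0.
  rewrite -ler_sqr ?nnegrE ?(ltW e_gt0)// -(ler_pM2l h2_gt0) -exprMn -normrM.
  have -> : h * (d - h^-1 *: ((u \o shift t) (h *: 1) - u t)) =
      - (u (t + h) - u t - h * d).
    by rewrite /= /GRing.scale/= mulr1 (addrC h); field.
  rewrite normrN real_normK ?num_real//; apply: le_trans (rem_le h h_le1) _.
  rewrite [_ ^+ 3]exprSr -mulrA ler_pM2l//.
  move: h_small; rewrite ler_pdivlMr ?ltr_wpDl//; apply: le_trans.
  by rewrite ler_wpM2l// (le_trans (ler_norm _))// lerDl.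
apply: DeriveDef; first by apply/cvg_ex; exists d.
by apply: cvg_lim => //; exact: Rhausdorff.
Unshelve. all: by end_near. Qed.

End Sobolev22.

Section UltraCompactness.
Context {R : realType} {X : Type} (U : set_system X) {UU : UltraFilter U}.
Notation mu := (@lebesgue_measure R).
Implicit Types (B M s t : R) (f v T : R -> R) (u g S : X -> R -> R).

Let PU : ProperFilter U := ultra_proper.

Lemma L2_primitive_ultra_limit S g T M : (forall j, periodic (S j) 1) ->
  (forall j, L2_primitive (S j) (g j)) -> (forall j, L2dot (g j) (g j) <= M) ->
  (forall t, S j t @[j --> U] --> T t) ->
  {uniform, S @ U --> T} /\ exists f, L2_primitive T f.
Proof.
move=> S_per Sg g_le ST; have S_cvg : {uniform, S @ U --> T}.
  apply: (periodic_pointwise_uniform_cvg S_per ST (C := M)) => j s t ts.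
  by apply: le_trans (L2_primitive_hoelder (Sg j) ts) _; exact: ler_wpM2l.
split=> //; have T_per := periodic_pointwise_limit (PF := PU) S_per ST.
have mu01 : (mu `[0%R, 1%R]%classic < +oo)%E by exact/compact_finite_measure/segment_compact.
have mg j : measurable_fun (`[0, 1]%classic : set (measurableTypeR R)) (g j).
  by have [_ [mgj _] _] := Sg j; exact: measurable_funTS.
have g2_int j : mu.-integrable `[0, 1] (EFin \o (fun x => g j x ^+ 2)).
  by have [_ [_ g2_int] _] := Sg j; exact: locally_integrable_itv.
have g2_le j : \int[mu]_(x in `[0, 1]) (g j x ^+ 2) <= M by rewrite -L2dot_sqr.
have [f0 f0_int g_f0] := ultra_weak_limit (mu := mu) (measurable_itv `[0, 1]) mu01 UU
  mg g2_int g2_le.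
have [s t s_ge0 st t_le1|f f_per Tf] := primitive_periodic_extension T_per f0_int.
  have sub01 : (`[s, t]%classic : set R) `<=` `[0, 1]%classic.
    by apply: subset_itv; rewrite bnd_simp.
  apply: (cvg_unique (@Rhausdorff R) _ (g_f0 _ (measurable_itv _) sub01)).
  rewrite (_ : (fun j => _) = (fun j => S j t - S j s)); first exact: cvgB.
  by apply/funext => j; have [_ _ [_ ->]] := Sg j.
by exists f; exact: L2_primitive_uniform_limit Sg g_le S_cvg f_per Tf.
Qed.

Lemma sobolev22_ultra_compact u g B M : (forall j, sobolev22 (u j) (g j)) ->
  (forall j t, `|u j t| <= B) -> (forall j t, `|derive1 (u j) t| <= B) ->
  (forall j, L2dot (g j) (g j) <= M) ->
  exists v f, [/\ sobolev22 v f, {uniform, u @ U --> v} &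
    {uniform, (fun j => derive1 (u j)) @ U --> derive1 v}].
Proof.
move=> ug u_le du_le g_le.
have u_per j : periodic (u j) 1 by case: (ug j).
have du_prim j : L2_primitive (derive1 (u j)) (g j) by case: (ug j).
have /choice[v uv] : forall t, exists l : R, u j t @[j --> U] --> l.
  by move=> t; apply: (@ultra_bounded_cvg _ _ U (u ^~ t) B).
have /choice[w duw] : forall t, exists l : R, derive1 (u j) t @[j --> U] --> l.
  by move=> t; apply: (@ultra_bounded_cvg _ _ U (fun j => derive1 (u j) t) B).
have [du_cvg [f wf]] := L2_primitive_ultra_limit (fun j => periodic_derive1 (u_per j))
  du_prim g_le duw.
have u_cvg : {uniform, u @ U --> v}.
  apply: (periodic_pointwise_uniform_cvg u_per uv (C := B ^+ 2)) => j s t ts.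
  have [_ du _] := ug j; have [c _] := MVT_increment s (t - s) du.
  rewrite (addrC s) subrK => ->; rewrite exprMn.
  apply: ler_pM; rewrite ?sqr_ge0//.
    by rewrite -real_normK ?num_real// expr2 ler_piMl.
  by rewrite -real_normK ?num_real// lerXn2r ?nnegrE// (le_trans _ (du_le j c)).
have v_der t : is_derive t 1 v (w t).
  apply: (@is_derive_taylor_remainder _ _ _ _ M) => h h_le1.
  apply: (@cvgr_to_le _ U PU _ (fun j => (u j (t + h) - u j t - h * derive1 (u j) t) ^+ 2)).
    rewrite expr2; under eq_fun do rewrite expr2.
    by apply: cvgM; apply: cvgB; [exact: cvgB|apply: cvgM; [exact: cvg_cst|exact: duw]
      |exact: cvgB|apply: cvgM; [exact: cvg_cst|exact: duw]].
  apply: nearW => j; apply: le_trans (sobolev22_taylor t (ug j) h_le1) _.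
  by rewrite ler_wpM2l// exprn_ge0.
have dv : derive1 v = w by apply/funext => t; rewrite derive1E; have [_] := v_der t.
exists v, f; rewrite dv; split=> //; split; rewrite ?dv//.
exact: periodic_pointwise_limit u_per uv.
Qed.

End UltraCompactness.

(** * Space curves *)

Lemma Rintegral_sum d (T : measurableType d) (R : realType)
    (mu : {measure set T -> \bar R}) (D : set T) (I : Type) (s : seq I)
    (f : I -> T -> R) :
  measurable D -> (forall i, mu.-integrable D (EFin \o f i)) ->
  \int[mu]_(x in D) (\sum_(i <- s) f i x) = \sum_(i <- s) \int[mu]_(x in D) f i x.
Proof.
move=> mD f_int; elim: s => [|i s IH].
  by rewrite big_nil; under eq_Rintegral do rewrite big_nil; rewrite Rintegral_cst// mul0r.
rewrite big_cons -IH -RintegralD//; first by apply: eq_Rintegral => x _; rewrite big_cons.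
have := integrable_sum mD s (P := predT) (fun i _ => f_int i).
by apply: eq_integrable => // x _; rewrite /= sumEFin.
Qed.

Lemma cvg_sum {R : numFieldType} {J : Type} (F : set_system J) {FF : Filter F} n
    (u : 'I_n -> J -> R) (l : 'I_n -> R) :
  (forall i, u i @ F --> l i) -> \sum_(i < n) u i j @[j --> F] --> \sum_(i < n) l i.
Proof. by move=> ul; apply: cvg_big => //; exact: add_continuous. Qed.

Section Vectors.
Context {R : realType}.
Implicit Types u v w : V3 R.

Lemma enorm_ge0 u : 0 <= enorm u. Proof. exact: sqrtr_ge0. Qed.

Lemma dot3_ge0 u : 0 <= dot3 u u.
Proof. by apply: sumr_ge0 => i _; rewrite -expr2 sqr_ge0. Qed.

Lemma enorm_sqr u : enorm u ^+ 2 = dot3 u u.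
Proof. by rewrite sqr_sqrtr// dot3_ge0. Qed.

Lemma dot3_eq0 u : (dot3 u u == 0) = (u == 0).
Proof.
apply/idP/eqP => [|->]; last by apply/eqP; apply: big1 => i _; rewrite mxE mul0r.
rewrite psumr_eq0 => [/allP u0|i _]; last by rewrite -expr2 sqr_ge0.
apply/rowP => i; rewrite mxE; have := u0 i; rewrite mem_index_enum mulf_eq0 orbb.
by move=> /(_ isT)/eqP.
Qed.

Lemma coord_le_enorm u i : `|u 0 i| <= enorm u.
Proof.
rewrite -sqrtr_sqr ler_wsqrtr// /dot3 (bigD1 i)//= -expr2 lerDl.
by apply: sumr_ge0 => j _; rewrite -expr2 sqr_ge0.
Qed.

Lemma enorm_le_coord u (B : R) : (forall i, `|u 0 i| <= B) -> enorm u <= 2 * B.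
Proof.
move=> u_le; have B_ge0 : 0 <= B by apply: le_trans (normr_ge0 _) (u_le 0).
rewrite -(ger0_norm (mulr_ge0 _ B_ge0))// -sqrtr_sqr ler_wsqrtr//.
apply: (@le_trans _ _ (\sum_(i < 3) B ^+ 2)).
  by apply: ler_sum => i _; rewrite -expr2 -real_normK ?num_real// lerXn2r ?nnegrE.
by rewrite sumr_const card_ord -mulr_natl; have := sqr_ge0 B; nra.
Qed.

Lemma sum_ord3 (f : 'I_3 -> R) :
  \sum_(i < 3) f i = f (inord 0) + f (inord 1) + f (inord 2).
Proof.
rewrite !big_ord_recl big_ord0 addr0 addrA.
by congr (_ + _ + _); congr f; apply/val_inj; rewrite /= inordK.
Qed.

Lemma dot3_cross u v :
  dot3 (cross u v) (cross u v) = dot3 u u * dot3 v v - dot3 u v ^+ 2.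
Proof.
have crossE k : (k < 3)%N -> cross u v 0 (inord k) =
    u 0 (inord ((k + 1) %% 3)) * v 0 (inord ((k + 2) %% 3)) -
    u 0 (inord ((k + 2) %% 3)) * v 0 (inord ((k + 1) %% 3)).
  by move=> k3; rewrite mxE inordK.
by rewrite /dot3 !sum_ord3 !crossE//; ring.
Qed.

Lemma dot3_le_enorm u v : dot3 u v <= enorm u * enorm v.
Proof.
apply: le_trans (ler_norm _) _; rewrite -ler_sqr ?nnegrE ?mulr_ge0 ?enorm_ge0//.
by rewrite exprMn !enorm_sqr real_normK ?num_real// -subr_ge0 -dot3_cross dot3_ge0.
Qed.

Lemma ler_enormD u v : enorm (u + v) <= enorm u + enorm v.
Proof.
rewrite -ler_sqr ?nnegrE ?addr_ge0 ?enorm_ge0// sqrrD !enorm_sqr.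
have -> : dot3 (u + v) (u + v) = dot3 u u + dot3 u v *+ 2 + dot3 v v.
  by rewrite /dot3 !sum_ord3 !mxE; ring.
by rewrite lerD2r lerD2l lerMn2r dot3_le_enorm.
Qed.

Lemma enormN u : enorm (- u) = enorm u.
Proof. by congr Num.sqrt; apply: eq_bigr => i _; rewrite !mxE mulrNN. Qed.

Lemma enormZ (k : R) u : enorm (k *: u) = `|k| * enorm u.
Proof.
rewrite -sqrtr_sqr -sqrtrM ?sqr_ge0//; congr Num.sqrt.
by rewrite /dot3 mulr_sumr; apply: eq_bigr => i _; rewrite !mxE; ring.
Qed.

Lemma enorm_gt0 u : (0 < enorm u) = (u != 0).
Proof. by rewrite lt0r enorm_ge0 andbT -sqrf_eq0 enorm_sqr dot3_eq0. Qed.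

Lemma continuous_enorm_coord (T : topologicalType) (f : T -> V3 R) :
  (forall i, continuous (fun x => f x 0 i)) -> continuous (fun x => enorm (f x)).
Proof.
move=> f_cont x; apply: (@continuous_comp _ _ _ (fun y => dot3 (f y) (f y)) Num.sqrt).
  by apply: cvg_sum => i; apply: cvgM; exact: f_cont.
exact: sqrt_continuous.
Qed.

Lemma cross_shift_le u v k :
  enorm (cross u (k *: u + v)) <= enorm u * enorm v.
Proof.
rewrite -ler_sqr ?nnegrE ?mulr_ge0 ?enorm_ge0// exprMn !enorm_sqr.
have -> : dot3 (cross u (k *: u + v)) (cross u (k *: u + v)) =
    dot3 u u * dot3 v v - dot3 u v ^+ 2.
  by rewrite dot3_cross /dot3 !sum_ord3 !mxE; ring.
by rewrite gerBl sqr_ge0.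
Qed.

End Vectors.

Section Curves.
Context {R : realType}.
Notation mu := (@lebesgue_measure R).
Implicit Types (gamma beta u v : R -> V3 R) (g : 'I_3 -> R -> R) (i : 'I_3).

Definition coord i gamma (t : R) : R := gamma t 0 i.

Lemma derivable_coord i gamma t : derivable gamma t 1 ->
  derivable (coord i gamma) t 1.
Proof. by move=> /derivable_mxP; exact. Qed.

Lemma derive1_coord i gamma : (forall t, derivable gamma t 1) ->
  derive1 (coord i gamma) = coord i (derive1 gamma).
Proof. by move=> d; apply/funext => t; rewrite /coord !derive1E derive_mx// mxE. Qed.

Lemma derivable_of_coord gamma : (forall i t, derivable (coord i gamma) t 1) ->
  forall t, derivable gamma t 1.
Proof. by move=> d t; apply/derivable_mxP => i j; rewrite ord1; exact: d. Qed.

Lemma locally_integrable_dot3 u v : (forall i, locally_L2 (coord i u)) ->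
  (forall i, locally_L2 (coord i v)) ->
  locally_integrable (fun t => dot3 (u t) (v t)).
Proof.
move=> u_L2 v_L2; apply: itv_locally_integrable => n.
have uv_int i := locally_integrable_itv (- n%:R) n%:R (locally_L2M (u_L2 i) (v_L2 i)).
have := integrable_sum (mu := mu) (measurable_itv `[- n%:R, n%:R]) (index_enum 'I_3)
  (P := predT) (fun i _ => uv_int i).
by apply: eq_integrable => // t _; rewrite /= sumEFin.
Qed.

Let wdd_locally_L2 gamma v i : is_wdd gamma v -> locally_L2 (coord i v).
Proof.
move=> [v_per [mv [v2_fin _]]].
have mv01 j : measurable_fun (`[0, 1]%classic : set (measurableTypeR R)) (coord j v).
  exact: mv.
have v2_int : mu.-integrable `[0, 1] (EFin \o (fun t => coord i v t ^+ 2)).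
  apply/integrableP; split; first by apply/measurable_EFinP; exact: measurable_funX.
  apply: le_lt_trans v2_fin; apply: ge0_le_integral => //.
  - by apply: measurableT_comp => //; apply/measurable_EFinP; exact: measurable_funX.
  - apply/measurable_EFinP.
    apply: (eq_measurable_fun (fun t => dot3 (v t) (v t))) => [t _|].
      by rewrite enorm_sqr.
    by apply: measurable_sum => j; exact: measurable_funM.
  - move=> t _; rewrite lee_fin ger0_norm ?sqr_ge0// -real_normK ?num_real//.
    by rewrite lerXn2r ?nnegrE ?enorm_ge0// coord_le_enorm.
have [||mvi _ _] := periodic_locally_integrable (f := coord i v).
- by move=> t; rewrite /coord v_per.
- apply: integrable_sqr => //.
  exact/compact_finite_measure/segment_compact.
split=> //; apply: periodic_locally_integrable => // t; by rewrite /coord v_per.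
Qed.

Lemma W22_sobolev22 i gamma : W22 gamma ->
  sobolev22 (coord i gamma) (coord i (d2 gamma)).
Proof.
move=> [gamma_per [gamma_der gamma_wdd]].
have d2_wdd : is_wdd gamma (d2 gamma) by exact: (ClassicalEpsilon.epsilon_spec _ _ gamma_wdd).
have d2_L2 := wdd_locally_L2 i d2_wdd.
have [d2_per [_ [_ d2_int]]] := d2_wdd.
split=> [t|t|]; [by rewrite /coord gamma_per|exact: derivable_coord|].
rewrite derive1_coord//; split=> //; first by move=> t; rewrite /coord d2_per.
split; first exact: locally_L2_integrable.
by move=> s t /d2_int/(congr1 (fun w : V3 R => w 0 i)); rewrite !mxE.
Qed.

Lemma sobolev22_W22 gamma g : (forall i, sobolev22 (coord i gamma) (g i)) ->
  W22 gamma.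
Proof.
move=> gamma_g; have gamma_der : forall t, derivable gamma t 1.
  by apply: derivable_of_coord => i; have [] := gamma_g i.
split; first by move=> t; apply/rowP => i; have [/(_ t)] := gamma_g i.
split=> //; exists (fun t => \row_i g i t).
have g_prim i : L2_primitive (coord i (derive1 gamma)) (g i).
  by rewrite -derive1_coord//; have [] := gamma_g i.
split; first by move=> t; apply/rowP => i; rewrite !mxE; have [/(_ t)] := g_prim i.
split.
  move=> i; under eq_fun do rewrite mxE.
  by have [_ [mg _] _] := g_prim i; exact: measurable_funTS.
split; last first.
  move=> s t st; apply/rowP => i; rewrite !mxE; have [_ _ [_ /(_ s t st)]] := g_prim i.
  by rewrite /coord => ->; apply: eq_Rintegral => x _; rewrite mxE.
have coordE i : coord i (fun t => \row_i g i t) = g i.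
  by apply/funext => t; rewrite /coord mxE.
have g_L2 i : locally_L2 (coord i (fun t => \row_i g i t)).
  by rewrite coordE; have [] := g_prim i.
have /integrableP[_] := locally_integrable_itv 0 1 (locally_integrable_dot3 g_L2 g_L2).
congr (_ < _)%E; apply: eq_integral => t _.
by rewrite /= ger0_norm ?dot3_ge0// enorm_sqr.
Qed.

Definition L2dot3 u v : R := \sum_(i < 3) L2dot (coord i u) (coord i v).

Lemma L2dot3E u v : (forall i, locally_L2 (coord i u)) ->
  (forall i, locally_L2 (coord i v)) ->
  L2dot3 u v = \int[mu]_(t in `[0, 1]) dot3 (u t) (v t).
Proof.
move=> u_L2 v_L2; rewrite /L2dot3 /L2dot -Rintegral_sum// => i.
by apply: locally_integrable_itv; exact: locally_L2M.
Qed.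

Lemma L2dot3_polar_le u v : (forall i, locally_L2 (coord i u)) ->
  (forall i, locally_L2 (coord i v)) ->
  2 * L2dot3 u v - L2dot3 v v <= L2dot3 u u.
Proof.
move=> u_L2 v_L2; rewrite /L2dot3 mulr_sumr -sumrB.
by apply: ler_sum => i _; exact: L2dot_polar_le.
Qed.

Lemma L2dot_coord_le u i : L2dot (coord i u) (coord i u) <= L2dot3 u u.
Proof.
by rewrite /L2dot3 (bigD1 i)//= lerDl; apply: sumr_ge0 => j _; exact: L2dot_ge0.
Qed.

Lemma W22_locally_L2_d2 gamma i : W22 gamma -> locally_L2 (coord i (d2 gamma)).
Proof. by move=> /(W22_sobolev22 i)[_ _ []]. Qed.

Lemma W22_derivable gamma : W22 gamma -> forall t, derivable gamma t 1.
Proof. by case=> _ []. Qed.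

Lemma W22_coord_prim gamma i : W22 gamma ->
  L2_primitive (coord i (derive1 gamma)) (coord i (d2 gamma)).
Proof.
move=> gamma_W22; rewrite -derive1_coord; last exact: W22_derivable.
by have [] := W22_sobolev22 i gamma_W22.
Qed.

Lemma W22_continuous_coord gamma i : W22 gamma -> continuous (coord i gamma).
Proof. by move=> /(W22_sobolev22 i)[_ /derivable_continuous]. Qed.

Lemma W22_continuous_coord_derive1 gamma i : W22 gamma ->
  continuous (coord i (derive1 gamma)).
Proof. by move=> /(W22_coord_prim i)/L2_primitive_continuous. Qed.

Lemma ip22E u v : W22 u -> W22 v -> ip22 u v =
  L2dot3 u v + L2dot3 (derive1 u) (derive1 v) + L2dot3 (d2 u) (d2 v).
Proof.
move=> u_W22 v_W22.
have L2_coord w : W22 w -> [/\ forall i, locally_L2 (coord i w),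
    forall i, locally_L2 (coord i (derive1 w)) & forall i, locally_L2 (coord i (d2 w))].
  move=> w_W22; split=> i; last exact: W22_locally_L2_d2.
    exact/continuous_locally_L2/W22_continuous_coord.
  exact/continuous_locally_L2/W22_continuous_coord_derive1.
have [[u_L2 du_L2 ddu_L2] [v_L2 dv_L2 ddv_L2]] := (L2_coord u u_W22, L2_coord v v_W22).
have uv_int := locally_integrable_dot3 u_L2 v_L2.
have duv_int := locally_integrable_dot3 du_L2 dv_L2.
have dduv_int := locally_integrable_dot3 ddu_L2 ddv_L2.
rewrite !L2dot3E// /ip22 /I01 RintegralD ?RintegralD//; try exact: locally_integrable_itv.
exact/locally_integrable_itv/locally_integrableD.
Qed.

End Curves.

Section ArclengthCurves.
Context {R : realType}.
Notation mu := (@lebesgue_measure R).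
Implicit Types (gamma : R -> V3 R) (i : 'I_3).

Lemma arclength_dot3 gamma t : arclength gamma ->
  dot3 (derive1 gamma t) (derive1 gamma t) = 1.
Proof. by move=> gamma_arc; rewrite -enorm_sqr gamma_arc expr1n. Qed.

(* Differentiate |gamma'|^2 = 1 at the almost every point where gamma' has
   derivative gamma''. *)
Lemma arclength_orthogonal_ae gamma : W22 gamma -> arclength gamma ->
  {ae mu, forall t, dot3 (derive1 gamma t) (d2 gamma t) = 0}.
Proof.
move=> gamma_W22 gamma_arc.
have ae_filter : Filter (almost_everywhere mu) by exact: (ae_filter_ringOfSetsType mu).
have : {ae mu, forall (t : R) i,
    is_derive t 1 (coord i (derive1 gamma)) (coord i (d2 gamma) t)}.
  apply: filter_forall => i; apply: is_primitive_derive_ae.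
  by have [] := W22_coord_prim i gamma_W22.
apply: filterS => t dd.
have speed_der : is_derive t 1 (\sum_(i < 3) coord i (derive1 gamma) ^+ 2)
    (\sum_(i < 3) (2%:R * coord i (derive1 gamma) t ^+ 1) *: coord i (d2 gamma) t).
  by apply: is_derive_sum => i; exact: is_deriveX.
have speed_cst : \sum_(i < 3) coord i (derive1 gamma) ^+ 2 = cst 1.
  apply/funext => s; rewrite /= fct_sumE -(arclength_dot3 s gamma_arc).
  by apply: eq_bigr => i _; rewrite expr2.
rewrite speed_cst in speed_der; have := @derive_val _ _ _ _ _ _ _ speed_der.
rewrite derive_cst => /esym/eqP.
rewrite (_ : \sum_(i < 3) _ = 2 * dot3 (derive1 gamma t) (d2 gamma t)).
  by rewrite mulf_eq0 pnatr_eq0 => /eqP.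
rewrite /dot3 mulr_sumr; apply: eq_bigr => i _.
by rewrite expr1 /GRing.scale/= mulrA.
Qed.

Lemma bending_arclength gamma : W22 gamma -> arclength gamma ->
  bending gamma = (L2dot3 (d2 gamma) (d2 gamma))%:E.
Proof.
move=> gamma_W22 gamma_arc.
have dd_L2 i := W22_locally_L2_d2 i gamma_W22.
have d_L2 i : locally_L2 (coord i (derive1 gamma)).
  exact/continuous_locally_L2/W22_continuous_coord_derive1.
have dd2_int := locally_integrable_dot3 dd_L2 dd_L2.
have [mdd _ _] := dd2_int; have [md _ _] := locally_integrable_dot3 d_L2 dd_L2.
rewrite L2dot3E// /Rintegral fineK; last first.
  by apply: integrable_fin_num => //; exact: locally_integrable_itv.
transitivity (\int[mu]_(t in `[0%R, 1%R]) (dot3 (d2 gamma t) (d2 gamma t) -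
    dot3 (derive1 gamma t) (d2 gamma t) ^+ 2)%:E)%E.
  apply: eq_integral => t _; congr EFin.
  by rewrite /kappa gamma_arc expr1n invr1 !mulr1 enorm_sqr dot3_cross arclength_dot3// mul1r.
apply: ae_eq_integral => //.
- apply/measurable_EFinP; apply: measurable_funTS.
  by apply: measurable_funB => //; exact: measurable_funX.
- by apply/measurable_EFinP; exact: measurable_funTS.
- have := arclength_orthogonal_ae gamma_W22 gamma_arc.
  apply: filterS; first exact: (ae_filter_ringOfSetsType mu).
  by move=> t orth _; rewrite orth expr0n subr0.
Qed.

Lemma arclength_coord_derive1_le1 gamma i t : arclength gamma ->
  `|coord i (derive1 gamma) t| <= 1.
Proof. by move=> gamma_arc; rewrite -(gamma_arc t) coord_le_enorm. Qed.

(* The symmetry axes force gamma(0) and gamma(1/4) onto coordinate axes. *)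
Lemma D2sym_coord_zero gamma i : D2sym gamma ->
  exists2 s : R, 0 <= s <= 1 & coord i gamma s = 0.
Proof.
move=> [_ [_ [_ [sym1 [_ sym3]]]]].
have fixed_zero (k : 'I_3) s t (a b c : R) : diag3 a b c (gamma t) = gamma s ->
    t = s -> [:: a; b; c]`_k = -1 -> coord k gamma s = 0.
  move=> gamma_fixed ts k_opp; have := congr1 (fun v : V3 R => v 0 k) gamma_fixed.
  by rewrite ts mxE k_opp /coord; lra.
case: i => -[|[|[|//]]] i_lt.
- by exists 0; rewrite ?lexx ?ler01//; exact: fixed_zero (sym3 0) (oppr0 _) _.
- by exists 0; rewrite ?lexx ?ler01//; exact: fixed_zero (sym3 0) (oppr0 _) _.
- exists 4^-1; first by apply/andP; split; lra.
  by apply: fixed_zero (sym1 4^-1) _ _; [field|].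
Qed.

Lemma D2sym_coord_le1 gamma i t : W22 gamma -> arclength gamma -> D2sym gamma ->
  `|coord i gamma t| <= 1.
Proof.
move=> gamma_W22 gamma_arc gamma_sym.
have coord_per : periodic (coord i gamma) 1.
  by move=> s; rewrite /coord; have [_ [-> _]] := gamma_sym.
apply: (periodic_ind (P := fun x => `|x| <= 1) coord_per) => {}t /andP[t_ge0 t_lt1].
have [s /andP[s_ge0 s_le1] gamma_s] := D2sym_coord_zero i gamma_sym.
have gamma_der := W22_derivable gamma_W22.
have [c _] := MVT_increment s (t - s) (fun x => derivable_coord (i := i) (gamma_der x)).
rewrite gamma_s subr0 addrC subrK => ->; rewrite normrM derive1_coord//.
apply: (@le_trans _ _ (`|t - s| * 1)).
  by rewrite ler_wpM2l// arclength_coord_derive1_le1.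
by rewrite mulr1 ler_norml; apply/andP; split; lra.
Qed.

End ArclengthCurves.

Lemma subsequence_of_filter (U : set_system nat) (P : nat -> nat -> Prop) :
  ProperFilter U -> \oo `<=` U -> (forall k, U (P k)) ->
  exists2 phi : nat -> nat, forall k, (phi k < phi k.+1)%N & forall k, P k (phi k).
Proof.
move=> PU oo_U UP; have next k N : exists j, (N < j)%N /\ P k j.
  have UN : U [set j | (N < j)%N] by apply: oo_U; exists N.+1.
  by have [j [? ?]] := filter_ex (filterI UN (UP k)); exists j.
have /choice[f fP] : forall p : nat * nat, exists j, (p.2 < j)%N /\ P p.1 j.
  by move=> [k N]; exact: next.
pose phi := fix phi k := if k is m.+1 then f (m.+1, phi m) else f (0%N, 0%N).
exists phi => [k|[|k]] /=.
- exact: (fP (k.+1, phi k)).1.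
- exact: (fP (0%N, 0%N)).2.
- exact: (fP (k.+1, phi k)).2.
Qed.

Lemma cvg_subsequence {T : topologicalType} (u : nat -> T) (phi : nat -> nat) (l : T) :
  (forall k, (phi k < phi k.+1)%N) -> u @ \oo --> l -> (fun k => u (phi k)) @ \oo --> l.
Proof.
move=> phi_inc; have le_phi k : (k <= phi k)%N.
  by elim: k => [//|k IH]; exact: leq_ltn_trans IH (phi_inc k).
have phi_infty : phi @ \oo --> \oo.
  by move=> A [N _ NA]; exists N => // k Nk; exact/NA/(leq_trans Nk (le_phi k)).
exact: (@cvg_comp _ _ _ phi u).
Qed.

Section CurveConvergence.
Context {R : realType}.
Implicit Types (gamma : R -> V3 R) (i : 'I_3).

Definition C1_close (e : R) gamma beta := forall t : R,
  enorm (gamma t - beta t) < e /\ enorm (derive1 gamma t - derive1 beta t) < e.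

Lemma C1_close_near {J} (F : set_system J) {FF : Filter F} (G : J -> R -> V3 R) gamma :
  (forall i, {uniform, (fun j => coord i (G j)) @ F --> coord i gamma}) ->
  (forall i, {uniform, (fun j => coord i (derive1 (G j))) @ F -->
    coord i (derive1 gamma)}) ->
  forall e, 0 < e -> \forall j \near F, C1_close e (G j) gamma.
Proof.
move=> G_cvg dG_cvg e e_gt0; have e3_gt0 : 0 < e / 3 by rewrite divr_gt0.
have G_near : \forall j \near F, forall i t, `|coord i (G j) t - coord i gamma t| <= e / 3.
  by apply: filter_forall => i; have /uniform_cvgP := G_cvg i; exact.
have dG_near : \forall j \near F, forall i t,
    `|coord i (derive1 (G j)) t - coord i (derive1 gamma) t| <= e / 3.
  by apply: filter_forall => i; have /uniform_cvgP := dG_cvg i; exact.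
have enorm_lt (u : V3 R) : (forall i, `|u 0 i| <= e / 3) -> enorm u < e.
  by move=> /enorm_le_coord /le_lt_trans; apply; lra.
apply: filterS2 G_near dG_near => j G_le dG_le t.
by split; apply: enorm_lt => i; rewrite !mxE; [exact: G_le|exact: dG_le].
Qed.

Lemma C1_cvg_uniform (G : nat -> R -> V3 R) gamma : C1_cvg G gamma ->
  forall i, {uniform, (fun k => coord i (G k)) @ \oo --> coord i gamma} /\
    {uniform, (fun k => coord i (derive1 (G k))) @ \oo --> coord i (derive1 gamma)}.
Proof.
move=> G_cvg i; split; apply/uniform_cvgP => e /G_cvg; apply: filterS => k close t.
  have [/ltW + _] := close t; apply: le_trans.
  by have := coord_le_enorm (G k t - gamma t) i; rewrite !mxE.
have [_ /ltW] := close t; apply: le_trans.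
by have := coord_le_enorm (derive1 (G k) t - derive1 gamma t) i; rewrite !mxE.
Qed.

Section BoundedCurvature.
Variables (G : nat -> R -> V3 R) (gamma : R -> V3 R) (M : R).
Hypotheses (G_W22 : forall k, W22 (G k)) (gamma_W22 : W22 gamma).
Hypothesis G_le : forall k, L2dot3 (d2 (G k)) (d2 (G k)) <= M.
Hypothesis G_cvg : C1_cvg G gamma.

Lemma L2dot3_d2_cvg beta : W22 beta ->
  L2dot3 (d2 (G k)) (d2 beta) @[k --> \oo] --> L2dot3 (d2 gamma) (d2 beta).
Proof.
move=> beta_W22; apply: cvg_sum => i.
apply: (L2dot_cvg_weak (M := M) (fun k => W22_coord_prim i (G_W22 k)) _
  (W22_coord_prim i gamma_W22) (W22_coord_prim i beta_W22)).
- by move=> k; apply: le_trans (G_le k); exact: L2dot_coord_le.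
- by have [] := C1_cvg_uniform G_cvg i.
Qed.

Lemma C1_cvg_weak_W22_cvg : weak_W22_cvg G gamma.
Proof.
move=> beta beta_W22; rewrite (ip22E gamma_W22 beta_W22).
under eq_fun => k do rewrite (ip22E (G_W22 k) beta_W22).
apply: cvgD; last exact: (L2dot3_d2_cvg beta_W22).
apply: cvgD; apply: cvg_sum => i; have [u_cvg du_cvg] := C1_cvg_uniform G_cvg i.
  apply: L2dot_cvg_uniform u_cvg => [k||].
  - exact: (W22_continuous_coord (G_W22 k)).
  - exact: (W22_continuous_coord gamma_W22).
  - exact: (continuous_locally_L2 (W22_continuous_coord beta_W22)).
apply: L2dot_cvg_uniform du_cvg => [k||].
- exact: (W22_continuous_coord_derive1 (G_W22 k)).
- exact: (W22_continuous_coord_derive1 gamma_W22).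
- exact: (continuous_locally_L2 (W22_continuous_coord_derive1 beta_W22)).
Qed.

Lemma L2dot3_d2_lsc (c : nat -> R) (l : R) :
  (forall k, L2dot3 (d2 (G k)) (d2 (G k)) <= c k) -> c @ \oo --> l ->
  L2dot3 (d2 gamma) (d2 gamma) <= l.
Proof.
move=> G_le_c c_cvg.
have polar_cvg : 2 * L2dot3 (d2 (G k)) (d2 gamma) - L2dot3 (d2 gamma) (d2 gamma)
    @[k --> \oo] --> 2 * L2dot3 (d2 gamma) (d2 gamma) - L2dot3 (d2 gamma) (d2 gamma).
  by apply: cvgB; [apply: cvgM; [exact: cvg_cst|exact: L2dot3_d2_cvg]|exact: cvg_cst].
rewrite -[leLHS](addrK (L2dot3 (d2 gamma) (d2 gamma))) -mulr2n -mulr_natl.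
apply: ler_cvg_to polar_cvg c_cvg _; apply: nearW => k; apply: le_trans (G_le_c k).
by apply: L2dot3_polar_le => i;
  [exact: (W22_locally_L2_d2 i (G_W22 k))|exact: (W22_locally_L2_d2 i gamma_W22)].
Qed.

End BoundedCurvature.

End CurveConvergence.

(** * Compactness of symmetric arclength curves *)

Section D2symCompactness.
Context {R : realType}.
Implicit Types (gamma : R -> V3 R) (i : 'I_3).

Lemma arclength_curve_length gamma : arclength gamma -> curve_length gamma = 1.
Proof.
move=> gamma_arc; rewrite /curve_length /leb /I01; under eq_Rintegral do rewrite gamma_arc.
by rewrite Rintegral_cst// fine_lebesgue_measure_itv// subr0 mulr1.
Qed.

Section PointwiseLimit.
Context {J : Type} (F : set_system J) {PF : ProperFilter F}.
Variables (G : J -> R -> V3 R) (gamma : R -> V3 R).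

Lemma arclength_pointwise_limit : (forall j, arclength (G j)) ->
  (forall i t, coord i (derive1 (G j)) t @[j --> F] --> coord i (derive1 gamma) t) ->
  arclength gamma.
Proof.
move=> G_arc dG_cvg t; rewrite -[RHS]sqrtr1 /enorm; congr Num.sqrt.
have dot_cvg : dot3 (derive1 (G j) t) (derive1 (G j) t) @[j --> F] -->
    dot3 (derive1 gamma t) (derive1 gamma t).
  by apply: cvg_sum => i; apply: cvgM; exact: dG_cvg.
have dot_cst : (fun j => dot3 (derive1 (G j) t) (derive1 (G j) t)) = cst 1.
  by apply/funext => j; exact: arclength_dot3.
by rewrite dot_cst in dot_cvg; apply: (cvg_unique (@Rhausdorff R) dot_cvg); exact: cvg_cst.
Qed.

Hypothesis G_cvg : forall i t, coord i (G j) t @[j --> F] --> coord i gamma t.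

Lemma diag3_pointwise_limit a b c s t :
  (forall j, diag3 a b c (G j s) = G j t) -> diag3 a b c (gamma s) = gamma t.
Proof.
move=> G_sym; apply/rowP => i; rewrite mxE.
have scaled_cvg : [:: a; b; c]`_i * coord i (G j) s @[j --> F] -->
    [:: a; b; c]`_i * coord i gamma s.
  by apply: cvgM; [exact: cvg_cst|exact: G_cvg].
apply: (cvg_unique (@Rhausdorff R) scaled_cvg).
rewrite (_ : (fun j => _) = (fun j => coord i (G j) t)); first exact: G_cvg.
by apply/funext => j; rewrite /coord -G_sym mxE.
Qed.

Lemma D2sym_pointwise_limit : (forall j, D2sym (G j)) ->
  continuous gamma -> arclength gamma -> D2sym gamma.
Proof.
move=> G_sym gamma_cont gamma_arc; split=> //; split.
  move=> t; apply/rowP => i.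
  have coord_per : periodic (coord i gamma) 1.
    apply: (periodic_pointwise_limit (PF := PF) (u := fun j => coord i (G j))) => // j s.
    by rewrite /coord; have [_ [-> _]] := G_sym j.
  exact: coord_per.
split; first by rewrite arclength_curve_length.
by split; [|split] => t; apply: diag3_pointwise_limit => j;
  have [_ [_ [_ [sym1 [sym2 sym3]]]]] := G_sym j.
Qed.

End PointwiseLimit.

Lemma W22_continuous gamma : W22 gamma -> continuous gamma.
Proof.
move=> /W22_derivable gamma_der t; apply: differentiable_continuous.
exact/derivable1_diffP.
Qed.

Lemma W22_ultra_compact {X} (U : set_system X) {UU : UltraFilter U}
    (G : X -> R -> V3 R) (B M : R) : (forall j, W22 (G j)) ->
  (forall j i t, `|coord i (G j) t| <= B) ->
  (forall j i t, `|coord i (derive1 (G j)) t| <= B) ->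
  (forall j, L2dot3 (d2 (G j)) (d2 (G j)) <= M) ->
  exists2 gamma, W22 gamma & forall i,
    {uniform, (fun j => coord i (G j)) @ U --> coord i gamma} /\
    {uniform, (fun j => coord i (derive1 (G j))) @ U --> coord i (derive1 gamma)}.
Proof.
move=> G_W22 G_le dG_le ddG_le.
have /choice[v v_lim] : forall i, exists v : R -> R, exists2 f, sobolev22 v f &
    {uniform, (fun j => coord i (G j)) @ U --> v} /\
    {uniform, (fun j => coord i (derive1 (G j))) @ U --> derive1 v}.
  move=> i; have [||||v [f [vf v_cvg dv_cvg]]] :=
    @sobolev22_ultra_compact R X U UU (fun j => coord i (G j)) (fun j => coord i (d2 (G j))) B M.
  - by move=> j; exact: W22_sobolev22.
  - by move=> j t; exact: G_le.
  - by move=> j t; rewrite derive1_coord ?dG_le//; exact: W22_derivable.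
  - by move=> j; apply: le_trans (ddG_le j); exact: L2dot_coord_le.
  exists v, f => //; split=> //.
  rewrite (_ : (fun j => _) = (fun j => derive1 (coord i (G j))))//.
  by apply/funext => j; rewrite derive1_coord//; exact: W22_derivable.
have coordE i : coord i (fun t => \row_i v i t) = v i.
  by apply/funext => t; rewrite /coord mxE.
have /choice[f vf] : forall i, exists f, sobolev22 (v i) f.
  by move=> i; have [f vf _] := v_lim i; exists f.
have gamma_W22 : W22 (fun t => \row_i v i t).
  by apply: (sobolev22_W22 (g := f)) => i; rewrite coordE.
exists (fun t => \row_i v i t) => // i; have [_ _ [v_cvg dv_cvg]] := v_lim i.
by rewrite -derive1_coord ?coordE//; exact: W22_derivable.
Qed.

Lemma D2sym_sequentially_compact (G : nat -> R -> V3 R) (M : R) :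
  (forall j, W22 (G j)) -> (forall j, arclength (G j)) -> (forall j, D2sym (G j)) ->
  (forall j, L2dot3 (d2 (G j)) (d2 (G j)) <= M) ->
  exists gamma (phi : nat -> nat), [/\ W22 gamma, arclength gamma, D2sym gamma,
    (forall k, (phi k < phi k.+1)%N) & C1_cvg (fun k => G (phi k)) gamma].
Proof.
move=> G_W22 G_arc G_sym G_le.
have [U [UU oo_U]] := ultraFilterLemma (F := (\oo : set_system nat)) _.
have PU : ProperFilter U by exact: ultra_proper.
have [j i t|j i t|gamma gamma_W22 G_cvg] := W22_ultra_compact (U := U) (B := 1) G_W22 _ _ G_le.
- exact: D2sym_coord_le1.
- exact: arclength_coord_derive1_le1.
have gamma_arc : arclength gamma.
  apply: (arclength_pointwise_limit (F := U) G_arc) => i t.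
  by apply: (uniform_cvg_pointwise (u := fun j => coord i (derive1 (G j)))); have [] := G_cvg i.
have gamma_sym : D2sym gamma.
  apply: (D2sym_pointwise_limit (F := U)) G_sym _ gamma_arc => [i t|].
    by apply: (uniform_cvg_pointwise (u := fun j => coord i (G j))); have [] := G_cvg i.
  exact: W22_continuous.
have close_near e : 0 < e -> \forall j \near U, C1_close e (G j) gamma.
  by apply: C1_close_near => i; have [] := G_cvg i.
have [|phi phi_inc phi_close] :=
  subsequence_of_filter (P := fun k j => C1_close k.+1%:R^-1 (G j) gamma) PU oo_U.
  by move=> k; apply: close_near; rewrite invr_gt0.
exists gamma, phi.
split; [exact: gamma_W22|exact: gamma_arc|exact: gamma_sym|exact: phi_inc|].
move=> e e_gt0.
have /cvgrPdist_lt/(_ _ e_gt0) := @cvg_harmonic R; apply: filterS => k k_lt t.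
have {k_lt} k_lt : k.+1%:R^-1 < e.
  by move: k_lt; rewrite /= sub0r normrN ger0_norm// invr_ge0.
by have [close dclose] := phi_close k t; split; [exact: lt_trans close _|exact: lt_trans dclose _].
Qed.

End D2symCompactness.

(** * Finiteness of the tangent-point energy *)

Section DyadicFourthPowers.
Context {R : realType}.
Implicit Types (p q : R -> R).

Lemma pow2V_split n : 2 ^- n = 2 ^- n.+1 + 2 ^- n.+1 :> R.
Proof. by rewrite exprS; field; rewrite expf_neq0. Qed.

Lemma pow2V_gt0 n : 0 < 2 ^- n :> R.
Proof. by rewrite invr_gt0 exprn_gt0. Qed.

(* (p + q)^4 + (p - q)^4 = 2 p^4 + 12 p^2 q^2 + 2 q^4 *)
Lemma L2dot_fourth_power_le p q : continuous p -> continuous q ->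
  L2dot (fun s => (p s + q s) ^+ 2) (fun s => (p s + q s) ^+ 2) <=
  2 * L2dot (fun s => p s ^+ 2) (fun s => p s ^+ 2) +
  12 * L2dot (fun s => p s ^+ 2) (fun s => q s ^+ 2) +
  2 * L2dot (fun s => q s ^+ 2) (fun s => q s ^+ 2).
Proof.
move=> p_cont q_cont; have p2_L2 := continuous_locally_L2 (continuous_exprn (n := 2) p_cont).
have q2_L2 := continuous_locally_L2 (continuous_exprn (n := 2) q_cont).
have pq_L2 : locally_L2 (fun s => p s * q s).
  by apply: continuous_locally_L2 => s; apply: continuousM; [exact: p_cont|exact: q_cont].
have := L2dot_sqrD_le 2 (locally_L2D 1 p2_L2 q2_L2) pq_L2.
rewrite (_ : (fun s => p s ^+ 2 + 1 * q s ^+ 2 + 2 * (p s * q s)) =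
  (fun s => (p s + q s) ^+ 2)); last by apply/funext => s; ring.
have -> : L2dot (fun s => p s * q s) (fun s => p s * q s) =
    L2dot (fun s => p s ^+ 2) (fun s => q s ^+ 2).
  by apply: eq_Rintegral => s _; ring.
by rewrite L2dot_sqrD//; lra.
Qed.

Section Primitives.
Variables (f G A : R -> R).
Hypothesis Gf : L2_primitive G f.
Hypothesis A_prim : is_primitive A (fun x => f x ^+ 2).

Let phi n s := G (s + 2 ^- n) - G s.
Let chi n s := A (s + 2 ^- n) - A s.

Let f_per : periodic f 1. Proof. by case: Gf. Qed.

Let G_cont : continuous G. Proof. exact: L2_primitive_continuous Gf. Qed.

Let A_cont : continuous A. Proof. exact: is_primitive_continuous A_prim. Qed.

Let f2_per : periodic (fun x => f x ^+ 2) 1.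
Proof. by move=> x; rewrite f_per. Qed.

Let phi_cont n : continuous (phi n).
Proof. by move=> x; apply: cvgB; [exact: continuous_shift|exact: G_cont]. Qed.

Let chi_cont n : continuous (chi n).
Proof. by move=> x; apply: cvgB; [exact: continuous_shift|exact: A_cont]. Qed.

Let phi_per n : periodic (phi n) 1.
Proof.
move=> s; have [_ _ G_prim] := Gf.
by rewrite /phi addrAC !(is_primitive_periodicD1 _ G_prim f_per); ring.
Qed.

Let chi_per n : periodic (chi n) 1.
Proof.
by move=> s; rewrite /chi addrAC !(is_primitive_periodicD1 _ A_prim f2_per); ring.
Qed.

Let phi_split n s : phi n s = phi n.+1 s + phi n.+1 (s + 2 ^- n.+1).
Proof. by rewrite /phi pow2V_split addrA; ring. Qed.

Let chi_split n s : chi n s = chi n.+1 s + 1 * chi n.+1 (s + 2 ^- n.+1).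
Proof. by rewrite /chi pow2V_split addrA; ring. Qed.

Let phi_sqr_le n s : 2 ^+ n * phi n s ^+ 2 <= chi n s.
Proof.
have s_le : s <= s + 2 ^- n by rewrite lerDl ltW// pow2V_gt0.
have := L2_primitive_sqr_le Gf s_le; rewrite -(A_prim.2 _ _ s_le).
by rewrite addrAC subrr add0r ler_pdivlMl// exprn_gt0.
Qed.

Let alpha n := 8 ^+ n * L2dot (fun s => phi n s ^+ 2) (fun s => phi n s ^+ 2).
Let beta n := 2 ^+ n * L2dot (chi n) (chi n).

Let chi_L2 n : locally_L2 (chi n). Proof. exact: continuous_locally_L2. Qed.

Let chi_shift_L2 n d : locally_L2 (fun s => chi n (s + d)).
Proof. exact/continuous_locally_L2/continuous_shift. Qed.

Let phi2_le_chi n s : 0 <= 2 ^+ n * phi n s ^+ 2 <= chi n s.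
Proof. by rewrite phi_sqr_le andbT mulr_ge0 ?sqr_ge0// exprn_ge0. Qed.

Let pow8 n : 8 ^+ n = (2 ^+ n) ^+ 3 :> R.
Proof. by rewrite -exprM mulnC exprM; congr (_ ^+ n); ring. Qed.

Let alpha_le_beta n : alpha n <= beta n.
Proof.
have phi2_L2n : locally_L2 (fun s => phi n s ^+ 2).
  exact/continuous_locally_L2/continuous_exprn.
rewrite /alpha /beta pow8 exprS -mulrA ler_wpM2l ?exprn_ge0// -L2dotZ//.
by apply: ge0_le_L2dot; do [exact: phi2_le_chi|exact: locally_L2Z|exact: chi_L2].
Qed.

Let alpha_step n : alpha n <= alpha n.+1 / 2 + 3 / 2 * (beta n - beta n.+1).
Proof.
pose d : R := 2 ^- n.+1; pose p := phi n.+1; pose P := chi n.+1.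
pose q s := p (s + d); pose Q s := P (s + d); pose sq (u : R -> R) s := u s ^+ 2.
have p_cont : continuous p by exact: phi_cont.
have q_cont : continuous q by exact: continuous_shift.
have [p2_L2 q2_L2] : locally_L2 (sq p) /\ locally_L2 (sq q).
  by split; apply: continuous_locally_L2; exact: continuous_exprn.
have [P_L2 Q_L2] : locally_L2 P /\ locally_L2 Q.
  by split; [exact: chi_L2|exact: chi_shift_L2].
have phi_le : L2dot (sq (phi n)) (sq (phi n)) <=
    2 * L2dot (sq p) (sq p) + 12 * L2dot (sq p) (sq q) + 2 * L2dot (sq q) (sq q).
  rewrite (_ : sq (phi n) = (fun s => (p s + q s) ^+ 2)); first exact: L2dot_fourth_power_le.
  by apply/funext => s; rewrite /sq phi_split.
have q_shift : L2dot (sq q) (sq q) = L2dot (sq p) (sq p).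
  apply: (Rintegral_period_shift d (f := fun s => sq p s * sq p s)).
    by move=> s; rewrite /sq /p phi_per.
  exact: locally_L2M.
have chi_eq : L2dot (chi n) (chi n) = L2dot P P + 2 * L2dot P Q + L2dot Q Q.
  rewrite (_ : chi n = (fun s => P s + 1 * Q s)); last exact/funext/chi_split.
  by rewrite L2dot_sqrD// mulr1 expr1n mul1r.
have Q_shift : L2dot Q Q = L2dot P P.
  apply: (Rintegral_period_shift d (f := fun s => P s * P s)).
    by move=> s; rewrite /P chi_per.
  exact: locally_L2M.
have cross_le : (2 ^+ n.+1) ^+ 2 * L2dot (sq p) (sq q) <= L2dot P Q.
  rewrite -L2dotZ//.
  by apply: ge0_le_L2dot; do [move=> s; exact: phi2_le_chi|exact: locally_L2Z|].
rewrite /alpha /beta chi_eq Q_shift !pow8; rewrite q_shift in phi_le.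
move: phi_le cross_le; rewrite -/p -/P -/(sq p) -/(sq (phi n)) (exprS _ n).
move: (L2dot (sq (phi n)) _) (L2dot (sq p) (sq p)) (L2dot (sq p) (sq q)) (L2dot P Q) (L2dot P P).
have : 0 < 2 ^+ n :> R by rewrite exprn_gt0.
move: (2 ^+ n : R) => x x_gt0 a0 a1 m PQ PP a_le m_le.
have : x ^+ 3 * a0 <= x ^+ 3 * (2 * a1 + 12 * m + 2 * a1).
  by rewrite ler_wpM2l// exprn_ge0// ltW.
have : 3 * x * ((2 * x) ^+ 2 * m) <= 3 * x * PQ.
  by rewrite ler_wpM2l// mulr_ge0// ltW.
move: x_gt0 => _; lra.
Qed.

Lemma dyadic_fourth_power_sum_le N :
  \sum_(n < N) 8 ^+ n * L2dot (fun s => (G (s + 2 ^- n) - G s) ^+ 2)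
    (fun s => (G (s + 2 ^- n) - G s) ^+ 2) <= 3 * L2dot f f ^+ 2.
Proof.
have beta0 : beta 0 = L2dot f f ^+ 2.
  rewrite /beta expr0 mul1r /L2dot.
  under eq_Rintegral => s _ do rewrite /chi expr0 invr1 (is_primitive_periodicD1 _ A_prim f2_per)
    addrAC subrr add0r -L2dot_sqr -expr2.
  by rewrite Rintegral_cst// fine_lebesgue_measure_itv// subr0 mulr1.
have telescope : \sum_(n < N) alpha n <= alpha N - alpha 0 + 3 * (beta 0 - beta N).
  elim: N => [|N IH]; first by rewrite big_ord0 !subrr mulr0 addr0.
  by rewrite big_ord_recr/=; have := alpha_step N; lra.
have alpha0_ge0 : 0 <= alpha 0 by rewrite /alpha expr0 mul1r L2dot_ge0.
have beta_ge0 : 0 <= beta N by rewrite /beta mulr_ge0 ?exprn_ge0 ?L2dot_ge0.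
by rewrite -beta0; apply: le_trans telescope _; have := alpha_le_beta N; lra.
Qed.

End Primitives.
End DyadicFourthPowers.

Lemma periodic_continuous_bounds {R : realType} (u : R -> R) :
  continuous u -> periodic u 1 -> exists a b, forall t, u a <= u t <= u b.
Proof.
move=> u_cont u_per.
have [a _ a_min] := @EVT_min R u 0 1 ler01 (continuous_subspaceT u_cont).
have [b _ b_max] := @EVT_max R u 0 1 ler01 (continuous_subspaceT u_cont).
exists a, b; apply: (periodic_ind (P := fun y => u a <= y <= u b) u_per).
by move=> t /andP[t_ge0 /ltW t_le1]; rewrite a_min ?b_max// in_itv/= t_ge0.
Qed.

Lemma embedded_chord_neq0 {R : realType} (gamma : R -> V3 R) s h :
  periodic gamma 1 -> injective_mod1 gamma -> 0 < h < 1 ->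
  gamma (s + h) - gamma s != 0.
Proof.
move=> gamma_per gamma_inj /andP[h_gt0 h_lt1].
have chord_per : periodic (fun s => gamma (s + h) - gamma s) 1.
  by move=> x; rewrite addrAC !gamma_per.
have in01 (x : R) : 0 <= x -> x <= 1 -> x \in @I01 R.
  by move=> x_ge0 x_le1; rewrite inE /I01/= in_itv/= x_ge0.
apply: (periodic_ind (P := fun v => v != 0) chord_per) => {}s /andP[s_ge0 s_lt1].
rewrite subr_eq0; apply/eqP => chord0; have [sh_le1|sh_gt1] := leP (s + h) 1.
  have [||||s0 sh1] := gamma_inj s (s + h); last lra.
  - by apply: in01 => //; exact: ltW.
  - by apply: in01 => //; lra.
  - by rewrite ltrDl.
  - by rewrite chord0.
have [||||sh1 s1] := gamma_inj (s + h - 1) s; last lra.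
- by apply: in01; lra.
- by apply: in01 => //; exact: ltW.
- by lra.
- by rewrite -chord0 -[LHS]gamma_per subrK.
Qed.

Section RegularEmbeddedCurve.
Context {R : realType}.
Variable gamma : R -> V3 R.
Hypothesis gamma_W22 : W22 gamma.
Hypothesis gamma_regular : forall t, 0 < enorm (derive1 gamma t).
Hypothesis gamma_inj : injective_mod1 gamma.

Let gamma_per : periodic gamma 1. Proof. by case: gamma_W22. Qed.

Lemma W22_speed_continuous : continuous (fun t => enorm (derive1 gamma t)).
Proof. by apply: continuous_enorm_coord => i; exact: W22_continuous_coord_derive1. Qed.

Lemma W22_speed_bounds : exists m M : R,
  0 < m /\ forall t, m <= enorm (derive1 gamma t) <= M.
Proof.
have speed_per : periodic (fun t => enorm (derive1 gamma t)) 1.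
  by move=> t; rewrite periodic_derive1.
have [a [b ab_bound]] := periodic_continuous_bounds W22_speed_continuous speed_per.
by exists (enorm (derive1 gamma a)), (enorm (derive1 gamma b)).
Qed.

Definition taylor_remainder s h : V3 R := gamma (s + h) - gamma s - h *: derive1 gamma s.

Lemma chord_taylor s h :
  gamma (s + h) - gamma s = h *: derive1 gamma s + taylor_remainder s h.
Proof. by rewrite /taylor_remainder [RHS]addrC subrK. Qed.

Lemma taylor_remainder_sqrt_le s h : `|h| <= 1 -> enorm (taylor_remainder s h) <=
  2 * (`|h| * Num.sqrt (`|h| * L2dot3 (d2 gamma) (d2 gamma))).
Proof.
move=> h_le1; apply: enorm_le_coord => i.
rewrite -ler_sqr ?nnegrE ?mulr_ge0 ?sqrtr_ge0// exprMn sqr_sqrtr; last first.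
  by rewrite mulr_ge0// (le_trans (L2dot_ge0 _) (L2dot_coord_le _ i)).
rewrite real_normK ?num_real// mulrA -exprSr !mxE.
have := sobolev22_taylor s (W22_sobolev22 i gamma_W22) h_le1.
rewrite derive1_coord; last exact: W22_derivable.
by move=> /le_trans; apply; rewrite ler_wpM2l ?exprn_ge0// L2dot_coord_le.
Qed.

Let near_chord_lower_bound : exists2 d : R, 0 < d & exists2 c : R, 0 < c &
  forall s h, `|h| <= d -> c * `|h| <= enorm (gamma (s + h) - gamma s).
Proof.
have [m [M [m_gt0 speed_le]]] := W22_speed_bounds.
set E := L2dot3 (d2 gamma) (d2 gamma).
have E_ge0 : 0 <= E by apply: sumr_ge0 => i _; exact: L2dot_ge0.
pose d := Num.min 1 ((m / 4) ^+ 2 / (E + 1)).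
have d_gt0 : 0 < d by rewrite lt_min ltr01 divr_gt0 ?exprn_gt0 ?divr_gt0// ltr_wpDl.
exists d => //; exists (m / 2) => [|s h h_le]; first by rewrite divr_gt0.
have [h_le1 h_small] : `|h| <= 1 /\ `|h| * E <= (m / 4) ^+ 2.
  move: h_le; rewrite le_min => /andP[-> h_le]; split=> //.
  move: h_le; rewrite ler_pdivlMr ?ltr_wpDl//; apply: le_trans.
  by rewrite ler_wpM2l// lerDl.
have rem_le : enorm (taylor_remainder s h) <= 2 * (`|h| * (m / 4)).
  apply: le_trans (taylor_remainder_sqrt_le s h_le1) _.
  rewrite ler_wpM2l// ler_wpM2l// -[leRHS]ger0_norm ?divr_ge0 ?(ltW m_gt0)//.
  by rewrite -(sqrtr_sqr (m / 4)) ler_wsqrtr.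
have /andP[m_le _] := speed_le s.
have := ler_enormD (gamma (s + h) - gamma s) (- taylor_remainder s h).
rewrite chord_taylor addrK enormN enormZ -chord_taylor.
have : m * `|h| <= `|h| * enorm (derive1 gamma s) by rewrite mulrC ler_wpM2l.
by lra.
Qed.

Let far_chord_lower_bound d : 0 < d -> exists2 c : R, 0 < c &
  forall s h, d <= h <= 2^-1 -> c <= enorm (gamma (s + h) - gamma s).
Proof.
move=> d_gt0; have [d_le|d_gt] := leP d 2^-1; last first.
  exists 1 => // s h /andP[d_le h_le]; have := lt_le_trans d_gt d_le; lra.
pose K : set (R * R) := `[0, 1]%classic `*` `[d, 2^-1]%classic.
have K_compact : compact K by apply: compact_setX; exact: segment_compact.
have K_neq0 : K !=set0.
  by exists (0, d); split; rewrite /= in_itv/= lexx ?ler01 ?d_le.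
have chord_cont : continuous (fun p : R * R => enorm (gamma (p.1 + p.2) - gamma p.1)).
  apply: continuous_enorm_coord => i p.
  rewrite (_ : (fun q => _) = fun q : R * R => coord i gamma (q.1 + q.2) - coord i gamma q.1);
    last by apply/funext => q; rewrite !mxE.
  apply: cvgB; apply: continuous_comp; try exact: (W22_continuous_coord (i := i) gamma_W22).
    by apply: cvgD; [exact: cvg_fst|exact: cvg_snd].
  exact: cvg_fst.
have [p Kp p_min] := compact_EVT_min K_neq0 K_compact (continuous_subspaceT chord_cont).
exists (enorm (gamma (p.1 + p.2) - gamma p.1)) => [|s h h_itv].
  move: Kp; rewrite inE => -[_ /=]; rewrite in_itv/= => /andP[d_le_p p_le].
  by rewrite enorm_gt0 embedded_chord_neq0// (lt_le_trans d_gt0)//=; lra.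
have chord_per : periodic (fun s => enorm (gamma (s + h) - gamma s)) 1.
  by move=> x; rewrite addrAC !gamma_per.
move: s; apply: (periodic_ind (P := fun y => _ <= y) chord_per) => s /andP[s_ge0 /ltW s_le1].
by apply: (p_min (s, h)); rewrite inE; split; rewrite /= in_itv//= s_ge0.
Qed.

Lemma chord_lower_bound : exists2 c : R, 0 < c &
  forall s h, `|h| <= 2^-1 -> c * `|h| <= enorm (gamma (s + h) - gamma s).
Proof.
have [d d_gt0 [a a_gt0 near_le]] := near_chord_lower_bound.
have [b b_gt0 far_le] := far_chord_lower_bound d_gt0.
exists (Num.min a b) => [|s h h_le]; first by rewrite lt_min a_gt0.
have forward s' h' : 0 <= h' <= 2^-1 ->
    Num.min a b * h' <= enorm (gamma (s' + h') - gamma s').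
  move=> /andP[h'_ge0 h'_le]; have [h'_le_d|/ltW d_le_h'] := leP h' d.
    apply: (@le_trans _ _ (a * `|h'|)); last by apply: near_le; rewrite ger0_norm.
    by rewrite ger0_norm// ler_wpM2r// ge_min lexx.
  apply: le_trans (far_le s' h' _); last by rewrite d_le_h'.
  apply: (@le_trans _ _ (b * h')); first by rewrite ler_wpM2r// ge_min lexx orbT.
  by rewrite ler_piMr ?(ltW b_gt0)//; lra.
have [h_ge0|/ltW h_le0] := leP 0 h.
  by rewrite ger0_norm// forward// h_ge0 -(ger0_norm h_ge0).
rewrite -enormN opprB; have := forward (s + h) (- h).
by rewrite addrK (ler0_norm h_le0); apply; rewrite oppr_ge0 h_le0 -(ler0_norm h_le0).
Qed.

End RegularEmbeddedCurve.

Section CurvatureOscillation.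
Context {R : realType}.
Variable gamma : R -> V3 R.
Hypothesis gamma_W22 : W22 gamma.
Hypothesis gamma_regular : forall t, 0 < enorm (derive1 gamma t).
Hypothesis gamma_inj : injective_mod1 gamma.

Definition d2_norm1 (t : R) : R := \sum_(i < 3) `|coord i (d2 gamma) t|.

Definition d2_variation (r s : R) : R :=
  primitive d2_norm1 (s + r) - primitive d2_norm1 (s - r).

Lemma d2_norm1_ge0 t : 0 <= d2_norm1 t.
Proof. exact: sumr_ge0. Qed.

Lemma d2_norm1_locally_L2 : locally_L2 d2_norm1.
Proof.
have d2_L2 i := locally_L2_norm (W22_locally_L2_d2 i gamma_W22).
have := locally_L2D 1 (locally_L2D 1 (d2_L2 (inord 0)) (d2_L2 (inord 1))) (d2_L2 (inord 2)).
by congr locally_L2; apply/funext => x; rewrite /d2_norm1 sum_ord3 !mul1r.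
Qed.

Lemma primitive_d2_norm1 : is_primitive (primitive d2_norm1) d2_norm1.
Proof. exact/primitiveP/locally_L2_integrable/d2_norm1_locally_L2. Qed.

Lemma L2_primitive_d2_norm1 : L2_primitive (primitive d2_norm1) d2_norm1.
Proof.
split; [|exact: d2_norm1_locally_L2|exact: primitive_d2_norm1].
move=> t; apply: eq_bigr => i _.
by have [-> _ _] := W22_coord_prim i gamma_W22.
Qed.

Let primitive_homo : {homo primitive d2_norm1 : s t / s <= t}.
Proof.
move=> s t st; rewrite -subr_ge0; apply: le_trans (normr_ge0 _) _.
apply: (is_primitive_norm_le primitive_d2_norm1 primitive_d2_norm1) => // x.
by rewrite ger0_norm// d2_norm1_ge0.
Qed.

Lemma d2_variation_ge0 r s : 0 <= r -> 0 <= d2_variation r s.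
Proof. by move=> r_ge0; rewrite subr_ge0 primitive_homo//; lra. Qed.

Lemma d2_variation_homo s : {homo d2_variation^~ s : r1 r2 / r1 <= r2}.
Proof. by move=> r1 r2 r12; apply: lerB; apply: primitive_homo; lra. Qed.

Lemma continuous_d2_variation r : continuous (d2_variation r).
Proof.
have G_cont := L2_primitive_continuous L2_primitive_d2_norm1.
by move=> s; apply: cvgB; apply: continuous_shift.
Qed.

Lemma derive1_coord_variation_le i r s t : `|t - s| <= r ->
  `|coord i (derive1 gamma) t - coord i (derive1 gamma) s| <= d2_variation r s.
Proof.
have increment_le x y : x <= y -> `|coord i (derive1 gamma) y - coord i (derive1 gamma) x| <=
    primitive d2_norm1 y - primitive d2_norm1 x.
  have [_ _ T_prim] := W22_coord_prim i gamma_W22.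
  apply: (is_primitive_norm_le T_prim primitive_d2_norm1) => z.
  by rewrite /d2_norm1 (bigD1 i)//= lerDl sumr_ge0.
rewrite ler_norml => /andP[r_le le_r]; have [st|/ltW ts] := leP s t.
  by apply: le_trans (increment_le _ _ st) _; apply: lerB; apply: primitive_homo; lra.
rewrite distrC; apply: le_trans (increment_le _ _ ts) _.
by apply: lerB; apply: primitive_homo; lra.
Qed.

Lemma taylor_remainder_le s h :
  enorm (taylor_remainder gamma s h) <= 2 * (`|h| * d2_variation `|h| s).
Proof.
apply: enorm_le_coord => i; rewrite !mxE.
have coord_der t : derivable (coord i gamma) t 1 by exact/derivable_coord/W22_derivable.
have := MVT_increment s h coord_der; rewrite derive1_coord; last exact: W22_derivable.
move=> [c c_le]; rewrite /coord => ->; rewrite -mulrBr normrM ler_wpM2l//.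
exact: derive1_coord_variation_le.
Qed.

Lemma inv_rtp_ge0 s t : 0 <= inv_rtp gamma s t.
Proof.
by rewrite /inv_rtp; case: ifP => // _; rewrite divr_ge0 ?mulr_ge0 ?exprn_ge0 ?enorm_ge0.
Qed.

Lemma inv_rtp_le_variation : exists2 C : R, 0 < C & forall s h, 0 < `|h| <= 2^-1 ->
  inv_rtp gamma s (s + h) <= C * (d2_variation `|h| s / `|h|).
Proof.
have [c c_gt0 chord_ge] := chord_lower_bound gamma_W22 gamma_regular gamma_inj.
exists (4 / c ^+ 2) => [|s h /andP[h_gt0 h_le]]; first by rewrite divr_gt0 ?exprn_gt0.
have V_ge0 : 0 <= d2_variation `|h| s by exact: d2_variation_ge0.
rewrite /inv_rtp; case: ifPn => [_|chord_neq0].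
  by rewrite mulr_ge0 ?divr_ge0 ?exprn_ge0 ?(ltW c_gt0)// ltW.
set u := derive1 gamma s; set d := gamma (s + h) - gamma s.
have u_gt0 : 0 < enorm u by exact: gamma_regular.
have d_gt0 : 0 < enorm d by rewrite enorm_gt0.
rewrite ler_pdivrMr ?mulr_gt0 ?exprn_gt0//.
have cross_le : enorm (cross u d) <= enorm u * (2 * (`|h| * d2_variation `|h| s)).
  rewrite /d chord_taylor; apply: le_trans (cross_shift_le _ _ _) _.
  by rewrite ler_wpM2l ?enorm_ge0// taylor_remainder_le.
have d_ge : (c * `|h|) ^+ 2 <= enorm d ^+ 2.
  by rewrite lerXn2r ?nnegrE ?mulr_ge0 ?enorm_ge0 ?(ltW c_gt0)// chord_ge.
apply: (@le_trans _ _ (4 / c ^+ 2 * (d2_variation `|h| s / `|h|) *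
    (enorm u * (c * `|h|) ^+ 2))); last first.
  rewrite ler_wpM2l ?(ler_wpM2l (enorm_ge0 u))//.
  by rewrite mulr_ge0 ?divr_ge0 ?exprn_ge0 ?(ltW c_gt0)// ltW.
apply: le_trans (ler_wpM2l _ cross_le) _ => //.
by rewrite le_eqVlt; apply/orP; left; apply/eqP; field; rewrite !gt_eqF.
Qed.

End CurvatureOscillation.

Section CircleLayers.
Context {R : realType}.
Notation mu := (@lebesgue_measure R).

(* The integral of a nonnegative function is a supremum over simple minorants, so
   no measurability is needed. *)
Lemma ge0_le_integral_nomeas (D : set R) (f g : R -> \bar R) :
  (forall x, D x -> (0 <= f x)%E) -> (forall x, D x -> (f x <= g x)%E) ->
  (\int[mu]_(x in D) f x <= \int[mu]_(x in D) g x)%E.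
Proof.
move=> f_ge0 fg; rewrite !ge0_integralE//; last first.
  by move=> x Dx; exact: le_trans (f_ge0 x Dx) (fg x Dx).
apply: ge_ereal_sup => _ [h /= h_le <-]; apply: ereal_sup_ubound; exists h => //= x.
apply: le_trans (h_le x) _; rewrite !patchE; case: ifPn => //.
by rewrite inE => /fg.
Qed.

Lemma integral_cst_nneseries (a : R) (u : nat -> R -> \bar R) : 0 <= a ->
  (forall n x, (0 <= u n x)%E) ->
  (forall n, measurable_fun (`[0, 1]%classic : set (measurableTypeR R)) (u n)) ->
  (\int[mu]_(x in `[0%R, 1%R]) (a%:E + \sum_(n <oo) u n x) =
   a%:E + \sum_(n <oo) \int[mu]_(x in `[0%R, 1%R]) u n x)%E.
Proof.
move=> a_ge0 u_ge0 mu_u; rewrite ge0_integralD//=; last 2 first.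
- by move=> x _; exact: nneseries_ge0.
- by apply: ge0_emeasurable_sum.
rewrite integral_cst//= lebesgue_measure_itv/= lte_fin ltr01 sube0 mule1.
by rewrite integral_nneseries.
Qed.

Lemma dyadic_scale (h : R) : 0 < h <= 2^-1 -> exists n, 2 ^- n.+2 < h <= 2 ^- n.+1.
Proof.
move=> /andP[h_gt0 h_le].
have small : exists n, 2 ^- n.+2 < h.
  have /cvgrPdist_lt/(_ h h_gt0)[N _ Nh] : (fun n => (2^-1 : R) ^+ n) @ \oo --> 0.
    by apply: cvg_expr; rewrite ger0_norm ?invr_ge0// invf_lt1// ltr1n.
  exists N; have := Nh N.+2 (leq_trans (leqnSn N) (leqnSn _)).
  by rewrite sub0r normrN exprVn ger0_norm// ltW// pow2V_gt0.
exists (ex_minn small); case: ex_minnP => -[|m] -> m_min /=; first by rewrite expr1.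
by rewrite leNgt; apply/negP => /m_min; rewrite ltnn.
Qed.

(* The points of [0, 1] at distance at most r from s on the circle, for s in [0, 1]. *)
Definition circle_ball (r s : R) : set R :=
  `[s - r, s + r] `|` (`[s + 1 - r, s + 1 + r] `|` `[s - 1 - r, s - 1 + r]).

Lemma measurable_circle_ball r s :
  measurable (circle_ball r s : set (measurableTypeR R)).
Proof. by apply: measurableU => //; exact: measurableU. Qed.

Lemma lebesgue_measure_circle_ball_le r s : 0 <= r ->
  (mu (circle_ball r s) <= (6 * r)%:E)%E.
Proof.
move=> r_ge0; have mu_ball (x : R) : mu `[x - r, x + r]%classic = (2 * r)%:E.
  rewrite lebesgue_measure_itv/= lte_fin; case: ltP => [_|x_ge].
    by rewrite -EFinD; congr EFin; ring.
  by congr EFin; lra.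
have muU_le (A B : set (measurableTypeR R)) : measurable A -> measurable B ->
    (mu (A `|` B) <= mu A + mu B)%E by move=> ? ?; exact: measureU2.
apply: le_trans (muU_le _ _ _ _) _ => //; first exact: measurableU.
apply: le_trans (leeD2l _ (muU_le _ _ _ _)) _ => //.
by rewrite !mu_ball -!EFinD lee_fin; lra.
Qed.

Lemma circle_ball_offset (s t : R) : 0 <= s <= 1 -> 0 <= t <= 1 ->
  exists k : int, let h := t - s + k%:~R in
    `|h| <= 2^-1 /\ forall r, `|h| <= r -> circle_ball r s t.
Proof.
move=> s01 t01; have [lt_ts|] := ltP 2^-1 (t - s).
  exists (-1); rewrite mulrN1z; split=> [|r]; rewrite ler_norml => *; first lra.
  by right; left; rewrite /= in_itv/=; lra.
have [lt_st ts_le|ge_st le_st] := ltP (t - s) (- 2^-1).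
  exists 1; rewrite mulr1z; split=> [|r]; rewrite ler_norml => *; first lra.
  by right; right; rewrite /= in_itv/=; lra.
exists 0; rewrite mulr0z addr0; split=> [|r]; rewrite ler_norml => *; first lra.
by left; rewrite /= in_itv/=; lra.
Qed.

Lemma integral_circle_layers_le (F : R -> \bar R) (a s : R) (r c : nat -> R) :
  0 <= a -> (forall n, 0 <= r n) -> (forall n, 0 <= c n) ->
  (forall t, 0 <= t <= 1 -> (0 <= F t)%E) ->
  (forall t, 0 <= t <= 1 ->
    (F t <= a%:E + \sum_(n <oo) (c n * \1_(circle_ball (r n) s) t)%:E)%E) ->
  (\int[mu]_(t in `[0%R, 1%R]) F t <= a%:E + \sum_(n <oo) (c n * (6 * r n))%:E)%E.
Proof.
move=> a_ge0 r_ge0 c_ge0 F_ge0 F_le.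
have mB n := measurable_circle_ball (r n) s.
have layer_ge0 n t : (0 <= (c n * \1_(circle_ball (r n) s) t)%:E)%E.
  by rewrite lee_fin mulr_ge0.
apply: le_trans (ge0_le_integral_nomeas (g := fun t => _) _ _) _.
- by move=> t; rewrite /= in_itv/=; exact: F_ge0.
- by move=> t; rewrite /= in_itv/=; exact: F_le.
rewrite integral_cst_nneseries//; last first.
  by move=> n; apply/measurable_EFinP; apply: measurable_funM.
rewrite leeD2l//; apply: lee_nneseries => [n _ _|n _]; first exact: integral_ge0.
under eq_integral do rewrite EFinM.
rewrite ge0_integralZl//; [|exact/measurable_EFinP|by rewrite lee_fin].
rewrite integral_indic// EFinM lee_wpmul2l ?lee_fin//.
apply: le_trans (lebesgue_measure_circle_ball_le s (r_ge0 n)).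
by apply: le_measure; rewrite ?inE//; exact: measurableI.
Qed.

End CircleLayers.

Lemma powR_le1D {R : realType} (x q : R) n : 0 <= x -> 0 <= q <= n%:R ->
  x `^ q <= 1 + x ^+ n.
Proof.
move=> x_ge0 /andP[q_ge0 q_le]; have [x_le1|/ltW x_ge1] := leP x 1.
  apply: (@le_trans _ _ (1 `^ q)); last by rewrite powR1 lerDl exprn_ge0.
  by apply: ge0_ler_powR; rewrite ?nnegrE.
apply: (@le_trans _ _ (x ^+ n)); last by rewrite lerDr.
by rewrite -(powR_mulrn n x_ge0); exact: ler_powR.
Qed.

Section TangentPointEnergy.
Context {R : realType}.
Notation mu := (@lebesgue_measure R).
Variable gamma : R -> V3 R.
Hypothesis gamma_W22 : W22 gamma.
Hypothesis gamma_regular : forall t, 0 < enorm (derive1 gamma t).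
Hypothesis gamma_inj : injective_mod1 gamma.

Let V n s := d2_variation gamma (2 ^- n.+1) s.

Let V_ge0 n s : 0 <= V n s.
Proof. by apply: d2_variation_ge0 => //; rewrite ltW// pow2V_gt0. Qed.

Lemma inv_rtp_dyadic_le : exists2 C : R, 0 < C & forall s h n,
  2 ^- n.+2 < `|h| <= 2 ^- n.+1 -> `|h| <= 2^-1 ->
  inv_rtp gamma s (s + h) <= C * (2 ^+ n * V n s).
Proof.
have [C C_gt0 inv_le] := inv_rtp_le_variation gamma_W22 gamma_regular gamma_inj.
exists (4 * C) => [|s h n /andP[h_gt h_le] h_le2]; first by rewrite mulr_gt0.
have h_gt0 := lt_trans (pow2V_gt0 n.+2) h_gt.
apply: le_trans (inv_le s h _) _; first by rewrite h_gt0.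
have -> : 4 * C * (2 ^+ n * V n s) = C * (V n s * 2 ^+ n.+2) by rewrite !exprS; ring.
rewrite ler_wpM2l ?(ltW C_gt0)// ler_pM ?invr_ge0 ?d2_variation_ge0//.
  exact: d2_variation_homo.
by rewrite ltW// invf_plt ?posrE ?exprn_gt0.
Qed.

Lemma inv_rtp4_layers_le : exists2 C : R, 0 < C & forall s t,
  0 <= s <= 1 -> 0 <= t <= 1 ->
  ((inv_rtp gamma s t ^+ 4)%:E <=
   \sum_(n <oo) (C * (16 ^+ n * V n s ^+ 4) * \1_(circle_ball (2 ^- n.+1) s) t)%:E)%E.
Proof.
have [C C_gt0 inv_le] := inv_rtp_dyadic_le.
exists (C ^+ 4) => [|s t s01 t01]; first by rewrite exprn_gt0.
have layer_ge0 n :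
    (0 <= (C ^+ 4 * (16 ^+ n * V n s ^+ 4) * \1_(circle_ball (2 ^- n.+1) s) t)%:E)%E.
  by rewrite lee_fin !mulr_ge0 ?exprn_ge0 ?(ltW C_gt0).
have [k /= []] := circle_ball_offset s01 t01; set h := t - s + _ => h_le2 ball_t.
have -> : inv_rtp gamma s t = inv_rtp gamma s (s + h).
  have [gamma_per _] := gamma_W22.
  by rewrite /inv_rtp -(periodic_intr gamma_per t k) /h addrA subrKC.
have [->|h_neq0] := eqVneq h 0.
  by rewrite addr0 /inv_rtp subrr eqxx expr0n; exact: nneseries_ge0.
have [|n h_itv] := @dyadic_scale R `|h|; first by rewrite normr_gt0 h_neq0.
apply: le_trans (nneseries_lim_ge (P := xpredT) n.+1 (fun m _ _ => layer_ge0 m)).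
rewrite big_nat_recr//= -[leLHS]add0e leeD ?sume_ge0// lee_fin indicE mem_set; last first.
  by apply: ball_t; case/andP: h_itv.
rewrite mulr1 (_ : 16 = 2 ^+ 4 :> R); last by ring.
rewrite -exprM mulnC exprM -!exprMn lerXn2r ?nnegrE ?inv_rtp_ge0//.
- by rewrite !mulr_ge0 ?exprn_ge0 ?(ltW C_gt0).
- exact: inv_le.
Qed.

Lemma variation_fourth_power_sum_bounded : exists B : R, forall N,
  \sum_(n < N) 8 ^+ n * \int[mu]_(s in `[0, 1]) (V n s ^+ 4) <= B.
Proof.
pose f := d2_norm1 gamma; pose G := primitive f.
have Gf : L2_primitive G f := L2_primitive_d2_norm1 gamma_W22.
have [f_per [_ f2_int] G_prim] := Gf; have G_cont := L2_primitive_continuous Gf.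
exists (3 * L2dot f f ^+ 2) => N.
apply: le_trans (dyadic_fourth_power_sum_le Gf (primitiveP f2_int) N).
apply: ler_sum => n _; rewrite ler_wpM2l ?exprn_ge0// /L2dot.
pose dG s := G (s + 2 ^- n) - G s.
have dG_cont : continuous dG.
  by move=> s; apply: cvgB; [exact: continuous_shift|exact: G_cont].
rewrite -(Rintegral_period_shift (- 2 ^- n.+1) (f := fun s => dG s ^+ 2 * dG s ^+ 2)).
- rewrite le_eqVlt; apply/orP; left; apply/eqP; apply: eq_Rintegral => s _.
  rewrite -exprD; congr (_ ^+ _); rewrite /dG (pow2V_split n).
  by congr (G _ - G _); ring.
- move=> s; rewrite /dG addrAC !(is_primitive_periodicD1 _ G_prim f_per).
  by congr (_ ^+ 2 * _ ^+ 2); ring.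
- apply: continuous_locally_integrable => s.
  by apply: cvgM; exact: continuous_exprn.
Qed.

Let TP_inner_le q : 2 < q <= 4 -> exists M C : R, [/\ 0 <= M, 0 <= C & forall s,
  0 <= s <= 1 ->
  (\int[mu]_(t in `[0%R, 1%R]) (inv_rtp gamma s t `^ q * enorm (derive1 gamma s)
     * enorm (derive1 gamma t))%:E <=
   M%:E + \sum_(n <oo) (C * (8 ^+ n * V n s ^+ 4))%:E)%E].
Proof.
move=> /andP[q_gt2 q_le4]; have [C C_gt0 inv4_le] := inv_rtp4_layers_le.
have [m [M [m_gt0 speed_le]]] := W22_speed_bounds gamma_W22 gamma_regular.
have M_ge0 : 0 <= M.
  by have /andP[_] := speed_le 0; apply: le_trans; exact: enorm_ge0.
exists (M ^+ 2), (3 * (M ^+ 2 * C)); split=> [||s s01]; first exact: sqr_ge0.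
  by rewrite !mulr_ge0 ?(ltW C_gt0).
pose c n := M ^+ 2 * (C * (16 ^+ n * V n s ^+ 4)).
have c_ge0 n : 0 <= c n by rewrite !mulr_ge0 ?exprn_ge0 ?(ltW C_gt0).
have -> : (\sum_(n <oo) (3 * (M ^+ 2 * C) * (8 ^+ n * V n s ^+ 4))%:E =
    \sum_(n <oo) (c n * (6 * 2 ^- n.+1))%:E)%E.
  apply: eq_eseriesr => n _; congr EFin; rewrite /c.
  have -> : 16 ^+ n = 8 ^+ n * 2 ^+ n :> R by rewrite -exprMn; congr (_ ^+ n); ring.
  by rewrite (exprS _ n); field; rewrite expf_neq0.
apply: (integral_circle_layers_le (r := fun n => 2 ^- n.+1) _ _ c_ge0) => [|n||].
- exact: sqr_ge0.
- by rewrite ltW// pow2V_gt0.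
- by move=> t _; rewrite lee_fin !mulr_ge0 ?powR_ge0 ?enorm_ge0.
move=> t t01; apply: (@le_trans _ _ ((M ^+ 2)%:E + (M ^+ 2)%:E * (inv_rtp gamma s t ^+ 4)%:E)%E).
  rewrite -EFinM -EFinD lee_fin -{1}(mulr1 (M ^+ 2)) -mulrDr -mulrA [leRHS]mulrC.
  rewrite ler_pM ?powR_ge0 ?mulr_ge0 ?enorm_ge0//.
    by rewrite powR_le1D ?inv_rtp_ge0// q_le4 andbT; lra.
  have [/andP[_ s_le] /andP[_ t_le]] := (speed_le s, speed_le t).
  by rewrite expr2; exact: (ler_pM (enorm_ge0 _) (enorm_ge0 _) s_le t_le).
rewrite leeD2l//; apply: le_trans (lee_wpmul2l _ (inv4_le s t s01 t01)) _.
  by rewrite lee_fin sqr_ge0.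
rewrite -nneseriesZl; last by move=> n _; rewrite lee_fin !mulr_ge0 ?exprn_ge0 ?(ltW C_gt0).
apply: lee_nneseries => [n _ _|n _]; rewrite -EFinM.
  by rewrite lee_fin !mulr_ge0 ?exprn_ge0 ?(ltW C_gt0).
by rewrite /c !mulrA.
Qed.

Lemma TP_lty q : 2 < q <= 4 -> (TP q gamma < +oo)%E.
Proof.
move=> q_itv; have [M [C [M_ge0 C_ge0 inner_le]]] := TP_inner_le q_itv.
have [B sum_le] := variation_fourth_power_sum_bounded.
pose v n s := C * (8 ^+ n * V n s ^+ 4).
have v_ge0 n s : (0 <= (v n s)%:E)%E by rewrite lee_fin !mulr_ge0 ?exprn_ge0.
have V4_cont n : continuous (fun s => V n s ^+ 4).
  exact/continuous_exprn/continuous_d2_variation.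
have v_cont n : continuous (v n).
  by move=> s; do 2 (apply: cvgM; first exact: cvg_cst); exact: V4_cont.
have v_int n : (\int[mu]_(s in `[0%R, 1%R]) (v n s)%:E =
    (C * (8 ^+ n * \int[mu]_(s in `[0%R, 1%R]) (V n s ^+ 4)))%:E)%E.
  have V4_int := locally_integrable_itv 0 1 (continuous_locally_integrable (V4_cont n)).
  rewrite mulrA -RintegralZl//.
  under eq_Rintegral do rewrite -mulrA.
  rewrite /Rintegral fineK//; apply: integrable_fin_num => //.
  exact: (locally_integrable_itv 0 1 (continuous_locally_integrable (v_cont n))).
apply: (@le_lt_trans _ _ (M%:E + (C * B)%:E)%E); last by rewrite -EFinD ltry.
apply: le_trans (ge0_le_integral_nomeas (g := fun s => M%:E + \sum_(n <oo) (v n s)%:E)%E _ _) _.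
- by move=> s _; apply: integral_ge0 => t _; rewrite lee_fin !mulr_ge0 ?powR_ge0 ?enorm_ge0.
- by move=> s; rewrite /I01/= in_itv/=; exact: inner_le.
rewrite integral_cst_nneseries//; last first.
  by move=> n; apply/measurable_EFinP/measurable_funTS; exact: continuous_measurable_fun.
rewrite leeD2l//; apply: lime_le.
  by apply: is_cvg_nneseries => n _ _; exact: integral_ge0.
apply: nearW => N; under eq_bigr do rewrite v_int.
by rewrite sumEFin lee_fin -mulr_sumr ler_wpM2l// big_mkord.
Qed.

End TangentPointEnergy.

(** * Symmetric minimizers *)

Section RegularizedEnergies.
Context {R : realType}.
Variable q : R.
Hypothesis q_itv : 2 < q <= 4.
Implicit Types (theta : R) (gamma beta : R -> V3 R) (KK : set (set (V3 R))).

Lemma bending_ge0 gamma : (0 <= bending gamma)%E.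
Proof.
by apply: integral_ge0 => t _; rewrite lee_fin mulr_ge0 ?sqr_ge0 ?enorm_ge0.
Qed.

Lemma bending_le_Etheta theta gamma : 0 <= theta -> (bending gamma <= Etheta q theta gamma)%E.
Proof. by move=> theta_ge0; rewrite leeDl// mule_ge0 ?lee_fin ?poweR_ge0. Qed.

Lemma Etheta_CK KK beta : CK KK beta -> exists2 p, 0 <= p &
  forall theta, Etheta q theta beta = (bending beta + (theta * p)%:E)%E.
Proof.
move=> [beta_W22 [_ [beta_reg [beta_inj _]]]].
have TP_fin := TP_lty beta_W22 beta_reg beta_inj q_itv.
pose p := poweR (TP q beta) (1 / (q - 2)).
have p_fin : p \is a fin_num by rewrite ge0_fin_numE ?poweR_ge0// poweR_lty.
exists (fine p) => [|theta]; first by rewrite fine_ge0// poweR_ge0.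
by rewrite /Etheta EFinM fineK.
Qed.

End RegularizedEnergies.

Section SymmetricMinimizers.
Context {R : realType}.
Variables (q : R) (KK : set (set (V3 R))) (theta : nat -> R) (Gamma : nat -> R -> V3 R).
Hypothesis q_itv : 2 < q <= 4.
Hypothesis theta_gt0 : forall j, 0 < theta j.
Hypothesis theta_cvg : theta @ \oo --> 0.
Hypothesis Gamma_CK : forall j, CK KK (Gamma j).
Hypothesis Gamma_arc : forall j, arclength (Gamma j).
Hypothesis Gamma_sym : forall j, D2sym (Gamma j).
Hypothesis Gamma_min : forall j beta, CK KK beta -> D2sym beta ->
  (Etheta q (theta j) (Gamma j) <= Etheta q (theta j) beta)%E.

Lemma minimizer_W22 j : W22 (Gamma j).
Proof. by case: (Gamma_CK j). Qed.

Lemma minimizer_bending_le beta : CK KK beta -> D2sym beta -> exists2 p, 0 <= p &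
  forall j, ((L2dot3 (d2 (Gamma j)) (d2 (Gamma j)))%:E <= bending beta + (theta j * p)%:E)%E.
Proof.
move=> beta_CK beta_sym; have [p p_ge0 Etheta_beta] := Etheta_CK q_itv beta_CK.
exists p => // j; rewrite -bending_arclength//; last exact: minimizer_W22.
apply: le_trans (bending_le_Etheta q _ (ltW (theta_gt0 j))) _.
by rewrite -Etheta_beta; exact: Gamma_min.
Qed.

Lemma minimizer_L2dot3_d2_bounded : exists M, forall j,
  L2dot3 (d2 (Gamma j)) (d2 (Gamma j)) <= M.
Proof.
have [p p_ge0 Gamma_le] := minimizer_bending_le (Gamma_CK 0) (Gamma_sym 0).
have [|B [_ theta_le]] := @cvg_seq_bounded R R theta.
  by apply/cvg_ex; exists 0.
exists (L2dot3 (d2 (Gamma 0%N)) (d2 (Gamma 0%N)) + (B + 1) * p) => j.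
have := Gamma_le j; rewrite bending_arclength//; last exact: minimizer_W22.
rewrite -EFinD lee_fin => /le_trans; apply; rewrite lerD2l ler_wpM2r//.
by apply: le_trans (ler_norm _) _; apply: theta_le => //; rewrite ltrDl.
Qed.

Lemma minimizer_limit_bending_le (phi : nat -> nat) gamma beta :
  (forall k, (phi k < phi k.+1)%N) -> W22 gamma -> arclength gamma ->
  C1_cvg (fun k => Gamma (phi k)) gamma -> CK KK beta -> D2sym beta ->
  (bending gamma <= bending beta)%E.
Proof.
move=> phi_inc gamma_W22 gamma_arc Gamma_cvg beta_CK beta_sym.
have [->|bending_fin] := eqVneq (bending beta) +oo%E; first exact: leey.
have {bending_fin}bending_beta : bending beta = (fine (bending beta))%:E.
  by rewrite fineK// ge0_fin_numE ?bending_ge0// lt_neqAle bending_fin leey.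
have [M Gamma_le] := minimizer_L2dot3_d2_bounded.
have [p _ Gamma_beta] := minimizer_bending_le beta_CK beta_sym.
rewrite bending_arclength// bending_beta lee_fin.
apply: (L2dot3_d2_lsc (fun k => minimizer_W22 (phi k)) gamma_W22
  (fun k => Gamma_le (phi k)) Gamma_cvg
  (c := fun k => fine (bending beta) + theta (phi k) * p)) => [k|].
  by rewrite -lee_fin EFinD -bending_beta; exact: Gamma_beta.
rewrite -[X in _ --> X]addr0 -[X in _ + X](mul0r p).
apply: cvgD; first exact: cvg_cst.
by apply: cvgM; [exact: (cvg_subsequence phi_inc theta_cvg)|exact: cvg_cst].
Qed.

End SymmetricMinimizers.

Theorem theorem1p3 (R : realType) (q : R) (KK : set (set (V3 R)))
  (theta : nat -> R) (Gamma : nat -> R -> V3 R) :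
  2 < q <= 4 ->
  tame KK ->
  (exists beta, CK KK beta /\ D2sym beta) ->
  (forall j, 0 < theta j) ->
  theta @ \oo --> 0 ->
  (forall j, CK KK (Gamma j) /\ arclength (Gamma j) /\ D2sym (Gamma j) /\
     (forall beta, CK KK beta -> D2sym beta ->
        (Etheta q (theta j) (Gamma j) <= Etheta q (theta j) beta)%E)) ->
  exists (Gamma0 : R -> V3 R) (phi : nat -> nat),
    W22 Gamma0 /\ arclength Gamma0 /\ D2sym Gamma0 /\
    (forall k, (phi k < phi k.+1)%N) /\
    weak_W22_cvg (fun k => Gamma (phi k)) Gamma0 /\
    C1_cvg (fun k => Gamma (phi k)) Gamma0 /\
    (forall beta, CK KK beta -> D2sym beta -> (bending Gamma0 <= bending beta)%E).
Proof.
move=> q_itv _ _ theta_gt0 theta_cvg Gamma_spec.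
have Gamma_CK j : CK KK (Gamma j) by have [] := Gamma_spec j.
have Gamma_arc j : arclength (Gamma j) by have [_ []] := Gamma_spec j.
have Gamma_sym j : D2sym (Gamma j) by have [_ [_ []]] := Gamma_spec j.
have Gamma_min j := (Gamma_spec j).2.2.2.
have Gamma_W22 := minimizer_W22 Gamma_CK.
have [M Gamma_le] := minimizer_L2dot3_d2_bounded q_itv theta_gt0 theta_cvg
  Gamma_CK Gamma_arc Gamma_sym Gamma_min.
have [Gamma0 [phi [Gamma0_W22 Gamma0_arc Gamma0_sym phi_inc Gamma_cvg]]] :=
  D2sym_sequentially_compact Gamma_W22 Gamma_arc Gamma_sym Gamma_le.
exists Gamma0, phi; do 4 (split; first assumption).
split; first exact: (C1_cvg_weak_W22_cvg (fun k => Gamma_W22 (phi k)) Gamma0_W22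
  (fun k => Gamma_le (phi k)) Gamma_cvg).
split=> [|beta beta_CK beta_sym]; first exact: Gamma_cvg.
exact: (minimizer_limit_bending_le q_itv theta_gt0 theta_cvg Gamma_CK Gamma_arc
  Gamma_sym Gamma_min phi_inc Gamma0_W22 Gamma0_arc Gamma_cvg beta_CK beta_sym).
Qed.
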